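(* Let $\lambda$ be Lebesgue measure on $\mathbb{R}$, and let the maps $T$ on $[0,\frac12]$ and $T_o,T_e$ on $[-\frac12,\frac12]$ and the probability measures $\mu,\mu_o,\mu_e$ be as defined in the context. (i) With $q=0.288$, for every Borel set $E\subseteq[0,\frac12]$, $$\lambda(T^{-n}E)=\tfrac12\,\mu(E)+O(\mu(E)\,q^n).$$ (ii) With $q=0.288$, for every Borel set $E\subseteq[-\frac12,\frac12]$, $$\lambda(T_o^{-n}E)=\mu_o(E)+O(\mu_o(E)\,q^n).$$ (iii) With $q=0.234$, for every Borel set $E\subseteq[-\frac12,\frac12]$, $$\lambda(T_e^{-n}E)=\mu_e(E)+O(\mu_e(E)\,q^n).$$ In each part the $O$-estimate means: there is an absolute constant $C>0$, independent of $E$ and $n$, such that for all integers $n\ge1$ and all such $E$ the absolute value of the error term is at most $C$ times the quantity inside $O(\cdot)$.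
   Context: Let $G=\frac{\sqrt5+1}{2}$. The map $T:[0,\frac12]\to[0,\frac12]$ is defined by $T(0)=0$ and $T(x)=\left|\frac1x-\left\lfloor\frac1x+\frac12\right\rfloor\right|$ for $x\ne0$. The measure $\mu$ on $[0,\frac12]$ is the probability measure $d\mu=\frac{1}{\log G}\left(\frac{1}{G+x}+\frac{1}{G+1-x}\right)dx$. The map $T_o:[-\frac12,\frac12]\to[-\frac12,\frac12]$ is defined by $T_o(0)=0$ and $T_o(x)=\frac1x-\left\lfloor\frac1x+\frac12\right\rfloor$ for $x\neq0$. The measure $\mu_o$ on $[-\frac12,\frac12]$ is the probability measure $d\mu_o=\frac{1}{2\log G}\left(\frac{1}{G+|x|}+\frac{1}{G+1-|x|}\right)dx$. The map $T_e:[-\frac12,\frac12]\to[-\frac12,\frac12]$ is defined by $T_e(0)=0$ and $T_e(x)=\frac1{|x|}-\left\lfloor\frac1{|x|}+\frac12\right\rfloor$ for $x\ne0$. The measure $\mu_e$ on $[-\frac12,\frac12]$ is the probability measure $d\mu_e=h_e(x)\,dx$ with $h_e(x)=\frac{1}{\log G}\cdot\frac{1}{G+x}$ if $0<x<\frac12$ and $h_e(x)=\frac1{\log G}\cdot\frac1{G+x+1}$ if $-\frac12<x<0$. For a map $S$, $S^{-n}E$ denotes the preimage of $E$ under the $n$-th iterate of $S$. *)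

(* Defs.v *)
From HB Require Import structures.
From mathcomp Require Import all_boot all_order all_algebra.
From mathcomp Require Import all_classical all_reals all_analysis.
Set Implicit Arguments.
Unset Strict Implicit.
Unset Printing Implicit Defensive.
Import Order.TTheory GRing.Theory Num.Theory.
Local Open Scope classical_set_scope.
Local Open Scope ring_scope.

(* The maps below are total functions on R.  Only their restrictions to
   [unfolded_dom] or [folded_dom], which they send to themselves, matter:
   preimages under iterates are intersected with the domain in [preim_iter]. *)

Definition golden (R : realType) : R := (Num.sqrt 5 + 1) / 2.

Definition folded_dom (R : realType) : set R := `[0, 1 / 2].

Definition unfolded_dom (R : realType) : set R := `[- (1 / 2), 1 / 2].

Definition nearest_int (R : realType) (y : R) : R :=
  (Num.floor (y + 1 / 2))%:~R.

Definition T (R : realType) (x : R) : R :=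
  if x == 0 then 0 else `|1 / x - nearest_int (1 / x)|.

Definition To (R : realType) (x : R) : R :=
  if x == 0 then 0 else 1 / x - nearest_int (1 / x).

Definition Te (R : realType) (x : R) : R :=
  if x == 0 then 0 else 1 / `|x| - nearest_int (1 / `|x|).

Definition preim_iter (R : realType) (D : set R) (S : R -> R) (n : nat)
  (E : set R) : set R := D `&` (iter n S @^-1` E).

Definition h (R : realType) (x : R) : R :=
  1 / ln (golden R) * (1 / (golden R + x) + 1 / (golden R + 1 - x)).

Definition ho (R : realType) (x : R) : R :=
  1 / (2 * ln (golden R)) *
  (1 / (golden R + `|x|) + 1 / (golden R + 1 - `|x|)).

(* The value 0 at 0 and at the endpoints is immaterial. *)
Definition he (R : realType) (x : R) : R :=
  if (0 < x) && (x < 1 / 2) then 1 / ln (golden R) * (1 / (golden R + x))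
  else if (- (1 / 2) < x) && (x < 0) then
    1 / ln (golden R) * (1 / (golden R + x + 1))
  else 0.

Definition density_measure (R : realType) (D : set R) (f : R -> R)
  (E : set R) : \bar R :=
  (\int[@lebesgue_measure R]_(x in D `&` E) (f x)%:E)%E.

Definition mu (R : realType) : set R -> \bar R :=
  density_measure (@folded_dom R) (@h R).

Definition muo (R : realType) : set R -> \bar R :=
  density_measure (@unfolded_dom R) (@ho R).

Definition mue (R : realType) : set R -> \bar R :=
  density_measure (@unfolded_dom R) (@he R).

(* Main.v *)
(* The law of [T^n] under Lebesgue measure has a density [f_n * h], where [h] is
   the density of [mu], [f_0 = 1 / h] and [f_{n+1} = U f_n] with
     U f x = ((G + 1 - x) * V f x + (G + x) * V f (1 - x)) / (2 * G + 1),
     V f z = sum_j w_j(z) * f (1 / (j + 2 + z)),  0 <= z <= 1,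
     w_j(z) = (G + z) / ((G + z + j) * (G + z + j + 1)),  sum_j w_j(z) = 1.
   When [z] grows, the weights move towards larger [j] and the points
   [1 / (j + 2 + z)] decrease, so [V] maps nondecreasing functions to
   nonincreasing ones.  Hence if [f] is [L]-Lipschitz relative to an increasing
   [phi], then [V f] is [L]-Lipschitz relative to [V phi].  For
   [phi x = x / (1 + G * x)] the series telescopes to
   [V phi z = 1 / (2 * (G + 1 + z))], and an elementary estimate shows that [U]
   multiplies the Lipschitz constant relative to [phi] by at most 23/100.  So
   [f_n] tends to a constant at this rate, and the constant is 1/2.

   Both unfolded maps satisfy [|S x| = T |x|].  As [Te] is even, the law of
   [Te^(n+1)] is the image under [Te] of twice that of [T^n]; its density
   relative to [mue] is [2 * V f_n x] for [x > 0] and [2 * V f_n (1 + x)] for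
   [x < 0].  As [To] is odd outside the orbits that meet a rounding tie, the
   law of [To^n] at [E] is the sum of those of [T^n] at [E] and at [-E]. *)

Require Import Defs.
From HB Require Import structures.
From mathcomp Require Import all_boot all_order all_algebra.
From mathcomp Require Import all_classical all_reals all_analysis.
From mathcomp Require Import measurable_realfun zify ring lra.
Set Implicit Arguments.
Unset Strict Implicit.
Unset Printing Implicit Defensive.
Import Order.TTheory GRing.Theory Num.Theory.
Import numFieldNormedType.Exports.
Local Open Scope classical_set_scope.
Local Open Scope ring_scope.

(** * The golden ratio: its equation and rational bounds *)

Section Golden.
Context {R : realType}.
Local Notation G := (golden R).

Lemma golden_sqr : G * G = G + 1.
Proof.
have s5 : Num.sqrt (5 : R) * Num.sqrt 5 = 5 by rewrite -expr2 sqr_sqrtr.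
by rewrite /golden; nra.
Qed.

Lemma golden_gt : 8 / 5 < G.
Proof.
have s5 : Num.sqrt (5 : R) * Num.sqrt 5 = 5 by rewrite -expr2 sqr_sqrtr.
have := sqrtr_ge0 (5 : R); rewrite /golden; nra.
Qed.

Lemma golden_lt : G < 13 / 8.
Proof.
have s5 : Num.sqrt (5 : R) * Num.sqrt 5 = 5 by rewrite -expr2 sqr_sqrtr.
have := sqrtr_ge0 (5 : R); rewrite /golden; nra.
Qed.

Lemma ln_golden_gt0 : 0 < ln G.
Proof. by apply: ln_gt0; have := golden_gt; lra. Qed.

End Golden.

(** * The averaging operator and its contraction *)

Section Averaging.
Context {R : realType}.
Local Notation G := (golden R).
Implicit Types (f : R -> R) (x y z : R) (j N : nat).

Definition branch j z : R := 1 / (j.+2%:R + z).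

Definition weight j z : R := (G + z) / ((G + z + j%:R) * (G + z + j.+1%:R)).

Definition partial_avg f z N : R :=
  \sum_(j < N) weight j z * f (branch j z).

Definition avg f z : R := limn (partial_avg f z).

Lemma branch_itv j z : 0 <= z -> 0 < branch j z <= 1 / 2.
Proof.
move=> z0; have j0 : 0 <= j%:R :> R by rewrite ler0n.
rewrite /branch -(addn2 j) natrD; apply/andP; split.
  by rewrite divr_gt0//; lra.
by rewrite !mul1r lef_pV2 ?posrE; lra.
Qed.

Lemma branch_decr j z z' : 0 <= z -> z <= z' -> branch j z' <= branch j z.
Proof.
move=> z0 zz'; have j0 : 0 <= j%:R :> R by rewrite ler0n.
by rewrite /branch !mul1r lef_pV2 ?posrE -(addn2 j) natrD; lra.
Qed.

Lemma branch_decrS j z : 0 <= z -> branch j.+1 z <= branch j z.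
Proof.
move=> z0; have j0 : 0 <= j%:R :> R by rewrite ler0n.
by rewrite /branch !mul1r -(natr1 j.+2) -(addn2 j) natrD lef_pV2 ?posrE; lra.
Qed.

Lemma weight_ge0 j z : 0 <= z -> 0 <= weight j z.
Proof.
move=> z0; have G1 := @golden_gt R.
have j0 : 0 <= j%:R :> R by rewrite ler0n.
by rewrite divr_ge0 ?mulr_ge0 -?natr1//; lra.
Qed.

(** Closed form of the total weight of the branches with index at least [j]; it tends to [0], so the
    weights sum to [1]. *)
Definition tail_mass j z : R := (G + z) / (G + z + j%:R).

Lemma weightE j z : 0 <= z -> weight j z = tail_mass j z - tail_mass j.+1 z.
Proof.
move=> z0; have G1 := @golden_gt R.
have j0 : 0 <= j%:R :> R by rewrite ler0n.
rewrite /weight /tail_mass -natr1; field.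
by apply/andP; split; apply: lt0r_neq0; lra.
Qed.

Lemma tail_mass_incr j z z' : 0 <= z -> z <= z' -> tail_mass j z <= tail_mass j z'.
Proof.
move=> z0 zz'; have G1 := @golden_gt R.
have j0 : 0 <= j%:R :> R by rewrite ler0n.
rewrite /tail_mass ler_pdivrMr; last lra.
rewrite mulrAC ler_pdivlMr; last lra.
rewrite -subr_ge0 [leRHS](_ : _ = j%:R * (z' - z)); last by ring.
by apply: mulr_ge0; lra.
Qed.

Lemma sum_weight z N : 0 <= z -> \sum_(j < N) weight j z = 1 - tail_mass N z.
Proof.
move=> z0; have G1 := @golden_gt R.
elim: N => [|N IH].
  by rewrite big_ord0 /tail_mass addr0 divff ?subrr//; apply: lt0r_neq0; lra.
by rewrite big_ord_recr /= IH weightE//; ring.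
Qed.

Lemma tail_mass_ge0 j z : 0 <= z -> 0 <= tail_mass j z.
Proof.
move=> z0; have G1 := @golden_gt R.
have j0 : 0 <= j%:R :> R by rewrite ler0n.
by rewrite /tail_mass divr_ge0; lra.
Qed.

(* Since [1 / branch j z = G + z + j + (2 - G)], the composite
   [weight j z * flow (branch j z)] is a difference quotient that telescopes. *)
Definition flow x : R := x / (1 + G * x).

Definition avg_flow z : R := 1 / (2 * (G + 1 + z)).

(** With [a = G + z], the [j]-th term is [a / ((a + j) * (a + j + 1) * (a + j + 2))], which is
    [a / 2] times the drop of [1 / ((a + j) * (a + j + 1))] from [j] to [j + 1]; the subtracted
    fraction is what remains after [N] terms. *)
Lemma partial_avg_flow z N : 0 <= z ->
  partial_avg flow z N =
  avg_flow z - (G + z) / (2 * ((G + z + N%:R) * (G + z + N.+1%:R))).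
Proof.
move=> z0; have G1 := @golden_gt R.
elim: N => [|N IH].
  rewrite /partial_avg big_ord0 /avg_flow; field.
  by apply/andP; split; apply: lt0r_neq0; lra.
rewrite /partial_avg big_ord_recr /= -/(partial_avg flow z N) IH.
rewrite /weight /flow /branch -(natr1 N.+1) -(natr1 N).
have N0 : 0 <= N%:R :> R by rewrite ler0n.
field.
by rewrite !lt0r_neq0//; lra.
Qed.

End Averaging.

(** * Infinite averages and the contraction rate of the transfer operator *)

Section AveragingLimit.
Context {R : realType}.
Local Notation G := (golden R).
Implicit Types (f : R -> R) (x y z : R) (j N : nat).

Lemma cvg_harmonic_shift (c : R) : 0 < c ->
  (c / (c + n%:R)) @[n --> \oo] --> (0 : R).
Proof.
move=> c0.
(* Comparison with [(c + 1) / (n + 1)]: the cross products differ by [c * c + n], which is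
   nonnegative. *)
have hc : (c + 1) * n.+1%:R^-1 @[n --> \oo] --> (0 : R).
  rewrite -[0 in X in _ --> X](mulr0 (c + 1)).
  by apply: cvgM; [exact: cvg_cst|exact: cvg_harmonic].
apply: (squeeze_cvgr _ (cvg_cst 0) hc); near=> n.
have n0 : 0 <= n%:R :> R by rewrite ler0n.
apply/andP; split; first by rewrite divr_ge0; lra.
have -> : n.+1%:R = n%:R + 1 :> R by rewrite natr1.
rewrite ler_pdivrMr; last lra.
rewrite mulrAC ler_pdivlMr; last lra.
rewrite -subr_ge0 [leRHS](_ : _ = c * c + n%:R); last by ring.
by apply: addr_ge0 => //; apply: mulr_ge0; exact: ltW.
Unshelve. all: by end_near. Qed.

Lemma cvg_tail_mass z : 0 <= z -> tail_mass n z @[n --> \oo] --> (0 : R).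
Proof.
by move=> z0; apply: cvg_harmonic_shift; have := @golden_gt R; lra.
Qed.

Lemma cvg_partial_avg_flow z : 0 <= z ->
  partial_avg flow z N @[N --> \oo] --> avg_flow z.
Proof.
move=> z0; have G1 := @golden_gt R.
rewrite -[X in _ --> X]subr0; under eq_fun do rewrite partial_avg_flow//.
apply: cvgB; first exact: cvg_cst.
apply: (squeeze_cvgr _ (cvg_cst 0) (cvg_tail_mass z0)); near=> n.
have n0 : 0 <= n%:R :> R by rewrite ler0n.
apply/andP; split.
  by rewrite divr_ge0 ?mulr_ge0 -?natr1; lra.
rewrite /tail_mass ler_pM2l; last lra.
rewrite lef_pV2 ?posrE; [|by rewrite -?natr1 ?mulr_gt0; lra..].
rewrite mulrCA ler_peMr -?natr1; lra.
Unshelve. all: by end_near. Qed.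

(** As [z] grows, the points [branch j z] decrease and the weights move towards larger [j], where
    the points are smaller. Nonnegativity of [f] enters because the total weight [1 - tail_mass N z]
    of a finite sum drops as well. *)
Lemma partial_avg_antitone f z z' N : 0 <= z -> z <= z' ->
  (forall x, 0 <= x <= 1 / 2 -> 0 <= f x) ->
  (forall x y, 0 <= x -> x <= y -> y <= 1 / 2 -> f x <= f y) ->
  partial_avg f z' N <= partial_avg f z N.
Proof.
move=> z0 zz' f0 fi; have z'0 : 0 <= z' by exact: le_trans zz'.
have b0 j : 0 <= branch j z' <= 1 / 2.
  by have /andP[/ltW -> ->] := branch_itv j z'0.
apply: (@le_trans _ _ (\sum_(j < N) weight j z * f (branch j z'))); last first.
  apply: ler_sum => j _; apply: ler_wpM2l; first exact: weight_ge0.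
  apply: fi; [by case/andP: (b0 j) | exact: branch_decr|].
  by have /andP[] := branch_itv j z0.
pose D n := tail_mass n z' - tail_mass n z.
have D0 n : 0 <= D n by rewrite subr_ge0 tail_mass_incr.
rewrite -subr_ge0 /partial_avg -sumrB.
(* Summation by parts: the tails [tail_mass n] are larger at [z']. *)
suff : D N * f (branch N z') <=
    \sum_(j < N) (weight j z * f (branch j z') - weight j z' * f (branch j z')).
  by apply: le_trans; rewrite mulr_ge0// f0.
elim: N => [|N IH].
  by rewrite big_ord0 /D /tail_mass !addr0 !divff ?subrr ?mul0r// lt0r_neq0//;
    have := @golden_gt R; lra.
rewrite big_ord_recr /=.
apply: (le_trans _ (lerD IH (lexx _))).
rewrite !weightE//.
rewrite [leRHS](_ : _ = D N.+1 * f (branch N z')); last by rewrite /D; ring.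
apply: ler_wpM2l => //; apply: fi; [by case/andP: (b0 N.+1)| |by case/andP: (b0 N)].
exact: branch_decrS.
Qed.

(** Oscillation is measured in units of [flow], whose average is known exactly. The bounds by [0]
    and [M] make the averaging series monotone and convergent. *)
Definition flow_lipschitz (M L : R) f :=
  (forall x, 0 <= x <= 1 / 2 -> 0 <= f x <= M) /\
  (forall x y, 0 <= x -> x <= y -> y <= 1 / 2 ->
    `|f x - f y| <= L * (flow y - flow x)).

Lemma partial_avg_bounds M f z N : 0 <= z ->
  (forall x, 0 <= x <= 1 / 2 -> 0 <= f x <= M) ->
  0 <= partial_avg f z N <= M.
Proof.
move=> z0 fM.
have b0 j : 0 <= branch j z <= 1 / 2.
  by have /andP[/ltW -> ->] := branch_itv j z0.
apply/andP; split.
  apply: sumr_ge0 => j _; apply: mulr_ge0; first exact: weight_ge0.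
  by have /andP[] := fM _ (b0 j).
have M0 : 0 <= M by have /andP[] := fM _ (b0 0%N); exact: le_trans.
apply: (@le_trans _ _ (\sum_(j < N) weight j z * M)).
  apply: ler_sum => j _; apply: ler_wpM2l; first exact: weight_ge0.
  by have /andP[] := fM _ (b0 j).
rewrite -mulr_suml sum_weight// ler_piMl//.
by rewrite gerBl tail_mass_ge0.
Qed.

Lemma cvg_avg M f z : 0 <= z ->
  (forall x, 0 <= x <= 1 / 2 -> 0 <= f x <= M) ->
  partial_avg f z N @[N --> \oo] --> avg f z.
Proof.
move=> z0 fM; apply: nondecreasing_is_cvgn.
  apply/nondecreasing_seqP => n; rewrite /partial_avg big_ord_recr/= lerDl.
  apply: mulr_ge0; first exact: weight_ge0.
  have /andP[b1 b2] := branch_itv n z0.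
  by have /(fM _)/andP[] : 0 <= branch n z <= 1 / 2 by rewrite (ltW b1).
by exists M => _ [n _ <-]; have /andP[] := partial_avg_bounds n z0 fM.
Qed.

Lemma avg_bounds M f z : 0 <= z ->
  (forall x, 0 <= x <= 1 / 2 -> 0 <= f x <= M) -> 0 <= avg f z <= M.
Proof.
move=> z0 fM; have cf := cvg_avg z0 fM; apply/andP; split.
  apply: limr_ge; first by apply/cvg_ex; eexists; exact: cf.
  by apply: nearW => n; have /andP[] := partial_avg_bounds n z0 fM.
apply: limr_le; first by apply/cvg_ex; eexists; exact: cf.
by apply: nearW => n; have /andP[] := partial_avg_bounds n z0 fM.
Qed.

Lemma flow_ge0 x : 0 <= x -> 0 <= flow x.
Proof.
move=> x0; have G1 := @golden_gt R.
have : 0 <= G * x by apply: mulr_ge0; lra.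
by move=> ?; rewrite divr_ge0; lra.
Qed.

Lemma flowB x y : 0 <= x -> 0 <= y ->
  flow y - flow x = (y - x) / ((1 + G * x) * (1 + G * y)).
Proof.
move=> x0 y0; have G1 := @golden_gt R.
have ? : 0 <= G * x by apply: mulr_ge0; lra.
have ? : 0 <= G * y by apply: mulr_ge0; lra.
by rewrite /flow; field; rewrite !lt0r_neq0//; lra.
Qed.

Lemma partial_avgD f g z N :
  partial_avg (fun x => f x + g x) z N = partial_avg f z N + partial_avg g z N.
Proof. by rewrite -big_split; apply: eq_bigr => j _; rewrite mulrDr. Qed.

Lemma partial_avgZ (c : R) f z N :
  partial_avg (fun x => c * f x) z N = c * partial_avg f z N.
Proof. by rewrite /partial_avg mulr_sumr; apply: eq_bigr => j _; ring. Qed.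

Lemma partial_avg_cst (c : R) z N : 0 <= z ->
  partial_avg (fun=> c) z N = c * (1 - tail_mass N z).
Proof. by move=> z0; rewrite /partial_avg -mulr_suml sum_weight// mulrC. Qed.

(* [L * flow + f] and [L * flow + (M - f)] are nonnegative and nondecreasing,
   so averaging makes both nonincreasing in [z]. *)
Lemma avg_lip M L f z z' : 0 <= L -> flow_lipschitz M L f ->
  0 <= z -> z <= z' ->
  `|avg f z - avg f z'| <= L * (avg_flow z - avg_flow z').
Proof.
move=> L0 [fM fL] z0 zz'; have z'0 := le_trans z0 zz'.
have cz := cvg_avg z0 fM; have cz' := cvg_avg z'0 fM.
have pz := cvg_partial_avg_flow z0; have pz' := cvg_partial_avg_flow z'0.
have tz := cvg_tail_mass z0; have tz' := cvg_tail_mass z'0.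
have fl x y : 0 <= x -> x <= y -> y <= 1 / 2 ->
    L * flow x + f x <= L * flow y + f y /\
    L * flow x + (M + -1 * f x) <= L * flow y + (M + -1 * f y).
  move=> x0 xy y2; have := fL _ _ x0 xy y2.
  by rewrite ler_norml => /andP[]; split; lra.
have LF x : 0 <= x -> 0 <= L * flow x.
  by move=> x0; rewrite mulr_ge0 ?flow_ge0.
have key1 N : partial_avg f z' N - partial_avg f z N <=
    L * (partial_avg flow z N - partial_avg flow z' N).
  have := @partial_avg_antitone (fun x => L * flow x + f x) z z' N z0 zz'.
  rewrite !partial_avgD !partial_avgZ => H.
  suff : L * partial_avg flow z' N + partial_avg f z' N <=
      L * partial_avg flow z N + partial_avg f z N by lra.
  apply: H.
    by move=> x /[dup] /fM /andP[f0 _] /andP[x0 _]; rewrite addr_ge0// LF.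
  by move=> x y x0 xy y2; have [] := fl _ _ x0 xy y2.
(* The constant [M] is averaged with total weight [1 - tail_mass N]; this gives the extra term,
   which vanishes in the limit. *)
have key2 N : partial_avg f z N - partial_avg f z' N <=
    L * (partial_avg flow z N - partial_avg flow z' N)
    + M * (tail_mass N z' - tail_mass N z).
  have := @partial_avg_antitone
    (fun x => L * flow x + (M + -1 * f x)) z z' N z0 zz'.
  rewrite !(partial_avgD, partial_avgZ) !partial_avg_cst// => H.
  suff : L * partial_avg flow z' N +
       (M * (1 - tail_mass N z') + -1 * partial_avg f z' N) <=
      L * partial_avg flow z N +
      (M * (1 - tail_mass N z) + -1 * partial_avg f z N) by lra.
  apply: H.
    move=> x /[dup] /fM /andP[_ f1] /andP[x0 _].
    by rewrite addr_ge0 ?LF//; lra.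
  by move=> x y x0 xy y2; have [] := fl _ _ x0 xy y2.
rewrite ler_norml; apply/andP; split.
  rewrite -lerN2 opprK opprB.
  apply: ler_cvg_to (cvgB cz' cz) (cvgM (cvg_cst L) (cvgB pz pz')) _.
  exact: nearW key1.
have c2 : L * (partial_avg flow z N - partial_avg flow z' N)
    + M * (tail_mass N z' - tail_mass N z) @[N --> \oo] -->
    L * (avg_flow z - avg_flow z').
  rewrite -[X in _ --> X]addr0 -[X in _ --> _ + X](mulr0 M).
  rewrite -[X in _ --> _ + M * X](subrr 0).
  by apply: cvgD; apply: cvgM; [exact: cvg_cst|exact: cvgB
                               |exact: cvg_cst|exact: cvgB].
apply: ler_cvg_to (cvgB cz cz') c2 _; exact: nearW key2.
Qed.

(** Finite sums of weights fall short of [1], so [c] is first compared through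
    [c * (1 - tail_mass N z)], and the limit is taken afterwards. *)
Lemma avg_near M (c e : R) f z : 0 <= z ->
  (forall x, 0 <= x <= 1 / 2 -> 0 <= f x <= M) ->
  (forall x, 0 <= x <= 1 / 2 -> `|f x - c| <= e) -> `|avg f z - c| <= e.
Proof.
move=> z0 fM fc.
have b0 j : 0 <= branch j z <= 1 / 2.
  by have /andP[/ltW -> ->] := branch_itv j z0.
have e0 : 0 <= e by apply: le_trans (fc _ (b0 0%N)).
have cf := cvg_avg z0 fM.
have c1 : partial_avg f z N - c * (1 - tail_mass N z) @[N --> \oo] --> avg f z - c.
  have c2 : c * (1 - tail_mass N z) @[N --> \oo] --> c * (1 - 0).
    apply: cvgM; first exact: cvg_cst.
    by apply: cvgB; [exact: cvg_cst|exact: cvg_tail_mass].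
  by rewrite subr0 mulr1 in c2; exact: cvgB cf c2.
apply: (cvgr_to_le (cvg_norm c1)).
apply: nearW => N; rewrite -partial_avg_cst// -sumrB.
apply: le_trans (ler_norm_sum _ _ _) _.
apply: (@le_trans _ _ (\sum_(j < N) weight j z * e)).
  apply: ler_sum => j _; rewrite -mulrBr normrM ger0_norm ?weight_ge0//.
  by apply: ler_wpM2l; [exact: weight_ge0|exact: fc].
rewrite -mulr_suml sum_weight// ler_piMl//.
by rewrite gerBl tail_mass_ge0.
Qed.

(* Transfer operator of [T] on densities relative to [mu]: the two terms come
   from the inverse branches [1 / (k + x)] and [1 / (k - x)]. *)
Definition gauss_op f x : R :=
  ((G + 1 - x) * avg f x + (G + x) * avg f (1 - x)) / (2 * G + 1).

(** The coefficients [G + 1 - x] and [G + x] are nonnegative with sum [2 * G + 1]: a convex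
    combination of two averages. *)
Lemma gauss_op_bounds M f x : 0 <= x <= 1 / 2 ->
  (forall x, 0 <= x <= 1 / 2 -> 0 <= f x <= M) -> 0 <= gauss_op f x <= M.
Proof.
move=> /andP[x0 x2] fM; have G1 := @golden_gt R.
have /andP[v0 v1] := avg_bounds x0 fM.
have x1 : 0 <= 1 - x by lra.
have /andP[u0 u1] := avg_bounds x1 fM.
have a0 : 0 <= (G + 1 - x) * avg f x by apply: mulr_ge0; lra.
have b0 : 0 <= (G + x) * avg f (1 - x) by apply: mulr_ge0; lra.
have a1 : (G + 1 - x) * avg f x <= (G + 1 - x) * M by apply: ler_wpM2l; lra.
have b1 : (G + x) * avg f (1 - x) <= (G + x) * M by apply: ler_wpM2l; lra.
rewrite /gauss_op divr_ge0 ?addr_ge0//=; last lra.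
by rewrite ler_pdivrMr; lra.
Qed.

(** Below 0.234, the smaller rate of the theorem, and large enough for [9 / 25 * (2 * G + 2) <= 2 *
    rate * (2 * G + 1)], which is what [flow_contraction] comes down to. *)
Definition rate : R := 23 / 100.

(** The left side is what [avg_lip] with [L = 1] yields for an increment of
    [(2 * G + 1) * gauss_op f]. After multiplication by [(1 + G * x) * (1 + G * y)], each summand
    becomes [(y - x) / 2] times an affine coefficient times a product that is at most [9 / 25]. *)
Lemma flow_contraction x y : 0 <= x -> x <= y -> y <= 1 / 2 ->
  (G + 1 - x) * (avg_flow x - avg_flow y)
  + (G + x) * (avg_flow (1 - y) - avg_flow (1 - x))
  + (y - x) * (avg_flow y - avg_flow (1 - y)) <=
  rate * (2 * G + 1) * (flow y - flow x).
Proof.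
move=> x0 xy y2; have G1 := @golden_gt R; have G2 := @golden_lt R.
(* Linear arithmetic sees [G * x] and [G * y] as atoms; these facts place them between [0] and
   [13 / 8] times the variable. *)
have Gx : 0 <= G * x by apply: mulr_ge0; lra.
have Gy : 0 <= G * y by apply: mulr_ge0; lra.
have Gx2 : 0 <= (13 / 8 - G) * x by apply: mulr_ge0; lra.
have Gy2 : 0 <= (13 / 8 - G) * y by apply: mulr_ge0; lra.
rewrite flowB//; last lra.
(* Ratios of the factors [1 + G * t] to the denominators of [avg_flow t] and [avg_flow (1 - t)], up
   to the factor 2; both are at most [3 / 5] on [[0, 1/2]]. *)
pose a t := (1 + G * t) / (G + 1 + t).
pose b t := (1 + G * t) / (G + 2 - t).
have aE t : 0 <= t -> t <= 1 / 2 -> 0 <= G * t -> 0 <= (13 / 8 - G) * t ->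
    0 <= a t <= 3 / 5.
  by move=> t0 t2 ? ?; rewrite /a divr_ge0 ?ler_pdivrMr /=; lra.
have bE t : 0 <= t -> t <= 1 / 2 -> 0 <= G * t -> 0 <= (13 / 8 - G) * t ->
    0 <= b t <= 3 / 5.
  by move=> t0 t2 ? ?; rewrite /b divr_ge0 ?ler_pdivrMr /=; lra.
have [x2 y0] : x <= 1 / 2 /\ 0 <= y by lra.
have prod (s t : R) : 0 <= s <= 3 / 5 -> 0 <= t <= 3 / 5 ->
    s * t <= 9 / 25.
  move=> /andP[s0 s1] /andP[t0 t1].
  apply: (@le_trans _ _ (3 / 5 * (3 / 5))); last by lra.
  exact: ler_pM.
have aa := prod _ _ (aE x x0 x2 Gx Gx2) (aE y y0 y2 Gy Gy2).
have bb := prod _ _ (bE x x0 x2 Gx Gx2) (bE y y0 y2 Gy Gy2).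
have ab := prod _ _ (aE y y0 y2 Gy Gy2) (bE y y0 y2 Gy Gy2).
pose P := (1 + G * x) * (1 + G * y).
have P0 : 0 < P by rewrite /P; apply: mulr_gt0; lra.
rewrite mulrA ler_pdivlMr//.
have den := (@lt0r_neq0 R).
rewrite [leLHS](_ : _ = (y - x) / 2 * ((G + 1 - x) * (a x * a y)
   + (G + x) * (b x * b y)
   + (1 - 2 * y) * ((1 + G * x) / (G + 1 + y) * b y))); last first.
  rewrite /avg_flow /a /b /P; field.
  by rewrite !lt0r_neq0//; lra.
rewrite [leRHS](_ : _ = (y - x) / 2 * (2 * rate * (2 * G + 1))); last by field.
apply: ler_wpM2l; first lra.
(* The mixed summand is reduced to a product of [a] and [b] at the same point by [x <= y]. *)
have axy : (1 + G * x) / (G + 1 + y) * b y <= a y * b y.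
  apply: ler_wpM2r; first by have /andP[] := bE y y0 y2 Gy Gy2.
  apply: ler_wpM2r; first by rewrite invr_ge0; lra.
  by rewrite lerD2l; apply: ler_wpM2l; lra.
have h1 : (G + 1 - x) * (a x * a y) <= (G + 1 - x) * (9 / 25).
  by apply: ler_wpM2l; lra.
have h2 : (G + x) * (b x * b y) <= (G + x) * (9 / 25).
  by apply: ler_wpM2l; lra.
have h3 : (1 - 2 * y) * ((1 + G * x) / (G + 1 + y) * b y) <=
    (1 - 2 * y) * (9 / 25).
  by apply: ler_wpM2l; lra.
by rewrite /rate; lra.
Qed.

Lemma gauss_op_lip M L f : 0 <= L -> flow_lipschitz M L f ->
  flow_lipschitz M (rate * L) (gauss_op f).
Proof.
move=> L0 fML; have [fM fL] := fML; split.
  by move=> x xI; exact: gauss_op_bounds.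
move=> x y x0 xy y2; have G1 := @golden_gt R.
have y0 : 0 <= y by lra.
have l1 := avg_lip L0 fML x0 xy.
have y1 : 0 <= 1 - y by lra.
have l2 : `|avg f (1 - y) - avg f (1 - x)| <=
  L * (avg_flow (1 - y) - avg_flow (1 - x)) by apply: (avg_lip L0 fML); lra.
have l3 : `|avg f y - avg f (1 - y)| <= L * (avg_flow y - avg_flow (1 - y)).
  by apply: (avg_lip L0 fML); lra.
have fc := ler_wpM2l L0 (flow_contraction x0 xy y2).
(* The first two differences have coefficients frozen at [x]; the third collects the variation of
   the coefficients. They match the three summands of [flow_contraction]. *)
rewrite [X in `|X|](_ : _ = ((G + 1 - x) * (avg f x - avg f y)
   - (G + x) * (avg f (1 - y) - avg f (1 - x))
   + (y - x) * (avg f y - avg f (1 - y))) / (2 * G + 1)); last first.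
  by rewrite /gauss_op; field; rewrite lt0r_neq0//; lra.
rewrite normrM (@ger0_norm _ (_^-1)); last by rewrite invr_ge0; lra.
rewrite ler_pdivrMr; last lra.
apply: le_trans (ler_normD _ _) _.
apply: le_trans (lerD (ler_normB _ _) (lexx _)) _.
rewrite !normrM (@ger0_norm _ (G + 1 - x)); last lra.
rewrite (@ger0_norm _ (G + x)); last lra.
rewrite (@ger0_norm _ (y - x)); last lra.
have m1 := @ler_wpM2l _ (G + 1 - x) _ _ _ l1.
have m2 := @ler_wpM2l _ (G + x) _ _ _ l2.
have m3 := @ler_wpM2l _ (y - x) _ _ _ l3.
have [? ?] : 0 <= G + 1 - x /\ 0 <= G + x by lra.
have ? : 0 <= y - x by lra.
have {}m1 := m1 ltac:(done); have {}m2 := m2 ltac:(done).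
have {}m3 := m3 ltac:(done).
lra.
Qed.

End AveragingLimit.

(** * Change of variables along inverse branches *)

Section Measurability.
Context {R : realType}.
Implicit Types (f g : R -> R) (a b c x y K : R).

Lemma lipschitz_within_continuous f a b K :
  (forall x y, a <= x -> x <= y -> y <= b -> `|f x - f y| <= K * (y - x)) ->
  {within `[a, b], continuous f}.
Proof.
move=> fK; apply/subspace_continuousP => x /=; rewrite in_itv/= => /andP[ax xb].
(* [K] carries no sign assumption; [|K| + 1] is a positive constant by which [e] can be divided. *)
have fK' y : a <= y <= b -> `|f x - f y| <= (`|K| + 1) * `|x - y|.
  move=> /andP[ay yb]; have [xy|/ltW yx] := leP x y.
    apply: le_trans (fK _ _ ax xy yb) _.
    rewrite distrC (ger0_norm (_ : 0 <= y - x)) ?subr_ge0//.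
    by apply: ler_wpM2r; rewrite ?subr_ge0//; have := ler_norm K; lra.
  rewrite distrC; apply: le_trans (fK _ _ ay yx xb) _.
  rewrite (ger0_norm (_ : 0 <= x - y)) ?subr_ge0//.
  by apply: ler_wpM2r; rewrite ?subr_ge0//; have := ler_norm K; lra.
have K0 : 0 < `|K| + 1 by rewrite ltr_wpDl.
apply/cvgrPdist_le => e e0.
rewrite near_withinE; near=> y => yab.
apply: le_trans (fK' _ _) _; first by move: yab; rewrite /= in_itv.
rewrite mulrC -ler_pdivlMr//.
by near: y; apply: cvgr_dist_le; [exact: cvg_id|exact: divr_gt0].
Unshelve. all: by end_near. Qed.

Lemma measurable_inv : measurable_fun setT (fun y : R => y^-1).
Proof.
rewrite [X in measurable_fun X](_ : _ = [set 0] `|` [set~ 0]); last first.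
  by apply/seteqP; split => x //= _; have [->|/eqP] := eqVneq x 0; [left|right].
apply/measurable_funU => //; first exact: measurableC.
split; first exact: measurable_fun_set1.
apply: subspace_continuous_measurable_fun; first exact: measurableC.
apply: continuous_in_subspaceT => x; rewrite inE/= => /eqP x0.
exact: inv_continuous.
Qed.

End Measurability.

(** * Image measures of densities *)

Section ImageDensity.
Context {R : realType}.
Local Open Scope ereal_scope.
Notation mR := (measurableTypeR R).
Variables (g : mR -> \bar R) (mg : measurable_fun setT g).
Hypothesis g0 : forall x, 0 <= g x.
Variables (v : mR -> mR) (mv : measurable_fun setT v).

(** The push-forward under [v] of the measure with density [g], made a measure so that two of them
    can be compared on a generating family. *)
Definition image_density (E : set mR) : \bar R :=
  \int[@lebesgue_measure R]_(x in v @^-1` E) g x.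

Let image_density0 : image_density set0 = 0.
Proof. by rewrite /image_density preimage_set0 integral_set0. Qed.

Let image_density_ge0 E : 0 <= image_density E.
Proof. by apply: integral_ge0 => x _. Qed.

Let image_density_sigma_additive : semi_sigma_additive image_density.
Proof.
have mpre A : measurable A -> measurable (v @^-1` A).
  by move=> mA; rewrite -[X in measurable X]setTI; exact: mv.
move=> A mA tA mUA; rewrite /image_density preimage_bigcup ge0_integral_bigcup//.
- by apply: is_cvg_ereal_nneg_natsum_cond => n _ _; exact: integral_ge0.
- by move=> k; exact: mpre.
- exact: measurable_funTS.
- by apply/trivIsetP => i j _ _ ij; rewrite -preimage_setI
    (trivIsetP.1 tA)// preimage_set0.
Qed.

Definition image_density_mixin := isMeasure.Build _ _ _ image_density
  image_density0 image_density_ge0 image_density_sigma_additive.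

End ImageDensity.

Section ChangeOfVariable.
Context {R : realType}.
Notation leb := (@lebesgue_measure R).
Implicit Types (F : R -> R) (a b c x y : R).

Lemma is_derive_shift_inv c x : 0 < c + x ->
  is_derive x 1 (fun x : R => 1 / (c + x)) (- (c + x) ^- 2).
Proof.
move=> cx; have cx0 : c + x != 0 by rewrite lt0r_neq0.
rewrite (_ : (fun x : R => _) = (fun x => ((cst c + id) x)^-1)); last first.
  by apply/funext => z; rewrite mul1r.
rewrite -[X in is_derive _ _ _ X]mulr1.
apply: is_deriveV => //=.
rewrite -[X in is_derive _ _ _ X]add0r; exact: is_deriveD.
Qed.

(** Substitution along a decreasing map; the minus sign of its derivative [- (c + x) ^- 2] cancels
    against the reversal of the endpoints. *)
Lemma integral_shift_inv F c a b : a <= b -> 0 < c + a ->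
  {within `[1 / (c + b), 1 / (c + a)], continuous F} ->
  (\int[leb]_(y in `[(1 / (c + b))%R, (1 / (c + a))%R]) (F y)%:E =
   \int[leb]_(x in `[a, b]) (F (1 / (c + x)) * (c + x) ^- 2)%R%:E)%E.
Proof.
move=> ab ca cF; pose u x := 1 / (c + x).
have du x : a <= x -> is_derive x 1 u (- (c + x) ^- 2).
  by move=> ax; apply: is_derive_shift_inv; apply: lt_le_trans ca _; rewrite lerD2l.
have du1 x : 0 < c + x -> derive1 u x = - (c + x) ^- 2.
  by move=> cx; rewrite derive1E; apply: derive_val; exact: is_derive_shift_inv.
have cu1 x : 0 < c + x -> derive1 u y @[y --> x] --> - (c + x) ^- 2.
  move=> cx.
  have cx0 : (c + x) ^+ 2 != 0 by rewrite expf_neq0// lt0r_neq0.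
  have h : (- (c + y) ^- 2) @[y --> x] --> - (c + x) ^- 2.
    apply: cvgN; apply: cvgV => //; rewrite expr2.
    under eq_fun do rewrite expr2.
    by apply: cvgM; apply: cvgD => //; exact: cvg_cst.
  apply: cvg_trans h; apply: near_eq_cvg; near=> y; rewrite du1//.
  rewrite -ltrBlDl sub0r; near: y; apply: lt_nbhsr.
  by rewrite -subr_gt0 opprK addrC.
have cax x : a <= x -> 0 < c + x.
  by move=> ax; apply: lt_le_trans ca _; rewrite lerD2l.
have cu x : a <= x -> {for x, continuous u}.
  move=> ax; apply: differentiable_continuous; apply/derivable1_diffP.
  by have := du x ax => -[].
rewrite (@integration_by_substitution_decreasing _ u F a b)//.
- apply: eq_integral => x; rewrite inE/= in_itv/= => /andP[ax xb].
  by rewrite !fctE /= du1 ?opprK// cax.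
- move=> x y; rewrite !in_itv/= => /andP[ax xb] /andP[ay yb] xy.
  by rewrite /u !mul1r ltf_pV2 ?posrE ?cax// ltrD2l.
- move=> x; rewrite in_itv/= => /andP[/ltW ax xb].
  by rewrite /continuous_at du1 ?cax//; apply: cu1; exact: cax.
- by apply/cvg_ex; exists (- (c + a) ^- 2); apply: cvg_at_right_filter; exact: cu1.
- apply/cvg_ex; exists (- (c + b) ^- 2); apply: cvg_at_left_filter; apply: cu1.
  exact: cax.
- split.
  + by move=> x; rewrite in_itv/= => /andP[/ltW ax xb]; have := du x ax => -[].
  + by apply: cvg_at_right_filter; exact: cu.
  + by apply: cvg_at_left_filter; exact: cu.
Unshelve. all: by end_near. Qed.

End ChangeOfVariable.

(** * The change of variables for Borel sets *)

Section BorelChangeOfVariable.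
Context {R : realType}.
Notation leb := (@lebesgue_measure R).
Implicit Types (F : R -> R) (a b c x y : R).

Lemma le_div1C x y : 0 < x -> 0 < y -> (y <= 1 / x) = (x <= 1 / y).
Proof. by move=> x0 y0; rewrite !ler_pdivlMr// mulrC. Qed.

Lemma ge_div1C x y : 0 < x -> 0 < y -> (1 / x <= y) = (1 / y <= x).
Proof. by move=> x0 y0; rewrite !ler_pdivrMr// mulrC. Qed.

(** On the image of a branch, the preimage of the half-line [[x, +oo[] is again an interval, to
    which [integral_shift_inv] applies. *)
Lemma branch_range c a b x y : 0 < c + a -> a <= b ->
  (1 / (c + b) <= y <= 1 / (c + a)) && (x <= 1 / y - c) =
  (1 / (c + b) <= y <= 1 / (c + Num.max a x)).
Proof.
move=> ca ab; rewrite -andbA; apply: andb_id2l => yb.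
have am : a <= Num.max a x by rewrite le_max lexx.
have cb : 0 < c + b by lra.
have y0 : 0 < y by apply: lt_le_trans yb; rewrite divr_gt0.
rewrite le_div1C// [RHS]le_div1C//; last lra.
by rewrite -!lerBrDl ge_max.
Qed.

Lemma measurable_shift_inv c A : measurable_fun A (fun y : R => 1 / y - c).
Proof.
apply: (measurable_funS measurableT) => //; apply: measurable_funB => //.
by apply: measurable_funM => //; exact: measurable_inv.
Qed.

Lemma shift_inv_itv c a b x : 0 < c + a -> a <= x <= b ->
  1 / (c + b) <= 1 / (c + x) <= 1 / (c + a).
Proof.
move=> ca /andP[ax xb].
by rewrite !mul1r !lef_pV2 ?posrE ?lerD2l ?ax ?xb//; lra.
Qed.

Lemma measurable_shift_inv_density F c a b : a <= b -> 0 < c + a ->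
  measurable_fun `[1 / (c + b), 1 / (c + a)] F ->
  measurable_fun `[a, b] (fun x => F (1 / (c + x)) * (c + x) ^- 2).
Proof.
move=> ab ca mF; apply: measurable_funM.
  apply: (measurable_comp _ _ mF) => //; last first.
    apply: (measurable_funS measurableT) => //; apply: measurable_funM => //.
    apply: (measurableT_comp measurable_inv); exact: measurable_funD.
  by move=> _ [x /= + <-]; rewrite !in_itv/=; exact: shift_inv_itv.
apply: (measurableT_comp measurable_inv); apply: measurable_funX.
exact: measurable_funD.
Qed.

(** Both sides are measures in [E]. They agree on the half-lines [[x, +oo[], which are stable under
    intersection and generate the Borel sets, so they agree everywhere. *)
Lemma borel_integral_shift_inv F c a b (E : set R) : a <= b -> 0 < c + a ->
  {within `[1 / (c + b), 1 / (c + a)], continuous F} ->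
  (forall y, 1 / (c + b) <= y <= 1 / (c + a) -> 0 <= F y) ->
  measurable E ->
  (\int[leb]_(y in `[(1 / (c + b))%R, (1 / (c + a))%R] `&`
      (fun y => 1 / y - c)%R @^-1` E) (F y)%:E =
   \int[leb]_(x in `[a, b] `&` E) (F (1 / (c + x)) * (c + x) ^- 2)%R%:E)%E.
Proof.
move=> ab ca cF F0 mE.
pose J : set R := `[1 / (c + b), 1 / (c + a)]%classic.
pose k x := F (1 / (c + x)) * (c + x) ^- 2.
pose v (y : R) := 1 / y - c.
have cax x : a <= x -> 0 < c + x by lra.
have kJ x : a <= x <= b -> 1 / (c + b) <= 1 / (c + x) <= 1 / (c + a).
  exact: shift_inv_itv.
have mJ : measurable J by exact: measurable_itv.
have mF : measurable_fun J F by apply: subspace_continuous_measurable_fun.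
have mk : measurable_fun `[a, b] k by exact: measurable_shift_inv_density.
pose g1 : measurableTypeR R -> \bar R := (EFin \o F) \_ J.
pose g2 : measurableTypeR R -> \bar R := (EFin \o k) \_ `[a, b].
have mg1 : measurable_fun setT g1.
  by apply/(measurable_restrictT _ _).1 => //; exact/measurable_EFinP.
have mg2 : measurable_fun setT g2.
  by apply/(measurable_restrictT _ _).1 => //; exact/measurable_EFinP.
have g10 y : (0 <= g1 y)%E.
  rewrite /g1 patchE; case: ifPn => //; rewrite inE /J/= in_itv/= => yJ.
  by rewrite lee_fin F0.
have g20 x : (0 <= g2 x)%E.
  rewrite /g2 patchE; case: ifPn => //; rewrite inE /= in_itv/= => xab.
  rewrite lee_fin mulr_ge0 ?F0 ?kJ// invr_ge0 exprn_ge0// ltW// cax//.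
  by case/andP: xab.
have mv : measurable_fun setT (v : measurableTypeR R -> measurableTypeR R).
  exact: measurable_shift_inv.
pose m3 : {measure set _ -> \bar R} :=
  HB.pack (image_density g1 v) (image_density_mixin mg1 g10 mv).
pose m2 : {measure set _ -> \bar R} :=
  HB.pack (image_density g2 id)
    (image_density_mixin mg2 g20 (@measurable_id _ _ setT)).
have m1E A : m3 A = (\int[leb]_(y in J `&` v @^-1` A) (F y)%:E)%E.
  by rewrite [RHS]integral_mkcondl.
have m2E A : m2 A = (\int[leb]_(x in `[a, b] `&` A) (k x)%:E)%E.
  by rewrite [RHS]integral_mkcondl.
rewrite -m1E -m2E.
apply: (@measure_unique _ R (measurableTypeR R) (@RGenCInfty.G R)
  (fun n => `[- n%:R, +oo[%classic) _ _ _ _ m3 m2 _ _ E mE).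
- exact: RGenCInfty.measurableE.
- move=> _ _ [x ->] [y ->]; exists (Num.max x y); apply/seteqP; split => z/=;
    rewrite !in_itv/= !andbT ge_max; first by case=> -> ->.
  by move=> /andP[].
- by move=> i; exists (- i%:R).
- apply/seteqP; split => // x _; exists (Num.trunc `|x|).+1 => //=.
  rewrite in_itv/= andbT lerNl; apply: le_trans (ltW (truncnS_gt _)).
  by rewrite -normrN; exact: ler_norm.
- move=> _ [x ->]; rewrite m1E m2E.
  (* For [x > b] both domains are empty; otherwise the lower endpoint becomes [Num.max a x]. *)
  have [xb|bx] := leP x b; last first.
    rewrite (_ : _ `&` _ = set0) ?integral_set0; last first.
      apply/seteqP; split => // y; rewrite /J /v/= !in_itv/= andbT.
      move=> [/andP[yb ya] xy].
      have cb := cax b ab; have b0 : 0 < 1 / (c + b) by rewrite divr_gt0.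
      have y0 : 0 < y by exact: lt_le_trans yb.
      have : 1 / y <= c + b; last lra.
      by rewrite ler_pdivrMr// mulrC -ler_pdivrMr.
    rewrite (_ : _ `&` _ = set0) ?integral_set0//.
    by apply/seteqP; split => // y; rewrite /= !in_itv/= andbT; lra.
  pose a' := Num.max a x.
  have a'b : a' <= b by rewrite ge_max ab.
  have aa' : a <= a' by rewrite le_max lexx.
  rewrite (_ : `[a, b] `&` _ = `[a', b]%classic); last first.
    apply/seteqP; split => y; rewrite /= !in_itv/= andbT ge_max.
      by move=> [/andP[-> ->] ->].
    by move=> /andP[/andP[-> ->] ->].
  rewrite (_ : J `&` _ = `[1 / (c + b), 1 / (c + a')]%classic); last first.
    apply/seteqP; split => y; rewrite /J /= !in_itv/= ?andbT.
      by move=> [yJ xy]; rewrite -branch_range// yJ.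
    by rewrite -branch_range// => /andP[].
  apply: integral_shift_inv => //; first exact: cax.
  apply: continuous_subspaceW cF => y /=; rewrite !in_itv/= => /andP[-> /=].
  by move=> /le_trans; apply; rewrite !mul1r lef_pV2 ?posrE ?cax// lerD2l.
(* Finiteness on the exhausting sets: a continuous function is integrable on a segment. *)
- move=> n; apply: (@le_lt_trans _ _ (m3 setT)).
    by apply: le_measure; rewrite ?inE.
  rewrite m1E preimage_setT setIT.
  have /integrableP[_] : leb.-integrable J (EFin \o F).
    by apply: continuous_compact_integrable => //; exact: segment_compact.
  apply: le_lt_trans; apply: ge0_le_integral => //.
  + exact/measurable_EFinP.
  + by apply/measurable_EFinP; apply: measurableT_comp.
  + by move=> y _; rewrite lee_fin ler_norm.
Qed.

End BorelChangeOfVariable.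

(** * The three maps and their inverse branches *)

Section CenteredFractionalPart.
Context {R : realType}.
Implicit Types (x y : R) (m : int).

Definition cfrac y : R := y - nearest_int y.

Lemma nearest_intE y m : - (1 / 2) <= y - m%:~R < 1 / 2 -> nearest_int y = m%:~R.
Proof.
move=> ym; congr (_%:~R); apply/eqP; rewrite floor_eq intrD; apply/andP; split; lra.
Qed.

Lemma cfrac_itv y : - (1 / 2) <= cfrac y < 1 / 2.
Proof.
rewrite /cfrac /nearest_int; have := floor_le (y + 1 / 2).
have := floorD1_gt (y + 1 / 2); rewrite intrD; lra.
Qed.

Lemma cfracE y m : - (1 / 2) <= y - m%:~R < 1 / 2 -> cfrac y = y - m%:~R.
Proof. by move=> ym; rewrite /cfrac (nearest_intE ym). Qed.

Lemma cfrac0 : cfrac 0 = 0.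
Proof. by rewrite (@cfracE 0 0) ?subr0//; lra. Qed.

(** Rounding is upwards at half-integers, so a tie gives [- (1 / 2)] at [y] and at [- y] alike; away
    from ties the integer nearest to [- y] is the opposite one. *)
Lemma cfracN y : cfrac y != - (1 / 2) -> cfrac (- y) = - cfrac y.
Proof.
move=> y2; have := cfrac_itv y; rewrite le_eqVlt eq_sym (negbTE y2)/=.
rewrite /cfrac /nearest_int; set m := Num.floor _ => ym.
rewrite -/(nearest_int _) (@nearest_intE _ (- m)) mulrNz; lra.
Qed.

Lemma normr_cfracN y : `|cfrac (- y)| = `|cfrac y|.
Proof.
have [yE|] := eqVneq (cfrac y) (- (1 / 2)); last first.
  by move=> /cfracN ->; rewrite normrN.
(* A tie means [y = m - 1 / 2], and then [- y = (1 - m) - 1 / 2] rounds to [1 - m]. *)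
rewrite (@cfracE (- y) (1 - Num.floor (y + 1 / 2))) ?intrB; last first.
  by move: yE; rewrite /cfrac /nearest_int; lra.
rewrite (_ : - y - _ = - (1 / 2)) ?yE//.
by move: yE; rewrite /cfrac /nearest_int; lra.
Qed.

(** Division by [0] returns [0] and [cfrac 0 = 0], so the case split at [0] disappears. *)
Lemma TeE x : Te x = cfrac (1 / `|x|).
Proof.
by rewrite /Te; case: eqP => // ->; rewrite normr0 invr0 mulr0 cfrac0.
Qed.

Lemma ToE x : To x = cfrac (1 / x).
Proof. by rewrite /To; case: eqP => // ->; rewrite invr0 mulr0 cfrac0. Qed.

Lemma TE x : T x = `|cfrac (1 / x)|.
Proof.
by rewrite /T; case: eqP => // ->; rewrite invr0 mulr0 cfrac0 normr0.
Qed.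

Lemma normr_Te x : `|Te x| = T x.
Proof.
rewrite TeE TE; have [x0|x0] := leP 0 x; first by rewrite (ger0_norm x0).
by rewrite (ltr0_norm x0) invrN mulrN normr_cfracN.
Qed.

Lemma normr_To x : `|To x| = T x.
Proof. by rewrite ToE TE. Qed.

Lemma T_norm x : T `|x| = T x.
Proof.
have [x0|x0] := leP 0 x; first by rewrite (ger0_norm x0).
by rewrite (ltr0_norm x0) !TE invrN mulrN normr_cfracN.
Qed.

Lemma Te_norm x : Te `|x| = Te x.
Proof. by rewrite !TeE normr_id. Qed.

Lemma T_itv x : 0 <= T x <= 1 / 2.
Proof.
rewrite TE normr_ge0/= ler_norml; have /andP[? /ltW ->] := cfrac_itv (1 / x).
by rewrite andbT.
Qed.

Lemma measurable_cfrac : measurable_fun setT cfrac.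
Proof.
apply: measurable_funB => //; apply: nondecreasing_measurable => // x y xy.
by rewrite /nearest_int ler_int; apply: le_floor; rewrite lerD2r.
Qed.

Lemma measurable_div1 : measurable_fun setT (fun x : R => 1 / x).
Proof. by apply: measurable_funM => //; exact: measurable_inv. Qed.

Lemma measurable_Te : measurable_fun setT (@Te R).
Proof.
rewrite (_ : @Te R = (cfrac \o (fun x => 1 / x)) \o Num.norm); last first.
  by apply/funext => x; rewrite TeE.
apply: measurableT_comp => //.
exact: (measurableT_comp measurable_cfrac measurable_div1).
Qed.

Lemma measurable_To : measurable_fun setT (@To R).
Proof.
rewrite (_ : @To R = cfrac \o (fun x => 1 / x)).
  exact: (measurableT_comp measurable_cfrac measurable_div1).
by apply/funext => x; rewrite ToE.
Qed.

Lemma measurable_T : measurable_fun setT (@T R).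
Proof.
rewrite (_ : @T R = Num.norm \o @To R).
  exact: (measurableT_comp _ measurable_To).
by apply/funext => x /=; rewrite normr_To.
Qed.

End CenteredFractionalPart.

Section IntegralModuloPoints.
Context {R : realType}.
Notation leb := (@lebesgue_measure R).

(** Serves to exchange half-open and closed intervals and to discard the point [0]. *)
Lemma integral_off_point (A B : set R) (r : R) (g : R -> \bar R) :
  measurable A -> measurable B -> A `<=` B -> B `\` A `<=` [set r] ->
  measurable_fun B g -> (forall x, B x -> 0 <= g x)%E ->
  (\int[leb]_(x in B) g x = \int[leb]_(x in A) g x)%E.
Proof.
move=> mA mB AB BA mg g0; rewrite -(setDUK AB) ge0_integral_setU ?setDUK//.
- by rewrite (integral_Sset1 _ BA) adde0.
- exact: measurableD.
- by apply/disj_setPS; rewrite setDIK.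
Qed.

Lemma integralN (A : set R) (g : R -> \bar R) :
  measurable A -> measurable_fun A g -> (forall x, A x -> 0 <= g x)%E ->
  (\int[leb]_(x in A) g x = \int[leb]_(x in -%R @^-1` A) g (- x)%R)%E.
Proof.
move=> mA mg g0.
transitivity (\int[pushforward leb (-%R : _ -> measurableTypeR R)]_(x in A) g x)%E.
  by apply: eq_measure_integral => //= B mB BA; exact/esym/lebesgue_measureN.
by rewrite ge0_integral_pushforward// => x; rewrite inE; exact: g0.
Qed.

End IntegralModuloPoints.

(** * Preimages under [Te] as disjoint unions over inverse branches *)

Section BranchDecomposition.
Context {R : realType}.
Notation leb := (@lebesgue_measure R).
Notation G := (golden R).
Implicit Types (f F : R -> R) (a b x y : R) (s j : nat).

(** The integer to which [1 / y] rounds. [s = 0] serves targets [x >= 0]; [s = 1] serves targets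
    [x <= 0], for which this integer starts at 3 because [1 / y >= 2]. *)
Definition branch_shift s j : R := j.+2%:R + s%:R.

Definition branch_cell s a b (E : set R) j : set R :=
  `[1 / (branch_shift s j + b), 1 / (branch_shift s j + a)] `&`
  (fun y => 1 / y - branch_shift s j) @^-1` E.

Lemma branch_shiftE s j : branch_shift s j = (j + 2 + s)%N%:R.
Proof. by rewrite /branch_shift -natrD addn2. Qed.

Lemma branch_shiftD_ge2 s j a : 0 <= s%:R + a -> 2 <= branch_shift s j + a.
Proof.
move=> sa; have j0 : 0 <= j%:R :> R by rewrite ler0n.
by rewrite /branch_shift -(addn2 j) natrD; lra.
Qed.

(** The branch of [y] is read off from the integer nearest to [1 / y]. The half-open interval around
    [E] follows the rounding convention, and [0] is removed because it lies on no branch. *)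
Lemma Te_preimage_branches s a b (E : set R) :
  0 <= s%:R + a -> s%:R + b <= 1 -> - (1 / 2) <= a -> b <= 1 / 2 ->
  E `<=` `[a, b[%classic ->
  (@folded_dom R `&` @Te R @^-1` E) `\ 0 = \bigcup_j branch_cell s a b E j.
Proof.
move=> sa sb a2 b2 Eab; apply/seteqP; split=> y.
  rewrite /folded_dom /= in_itv/= => -[[/andP[y0 y2] +] /eqP yn0].
  have {y0}y0 : 0 < y by rewrite lt_def yn0.
  rewrite TeE gtr0_norm//.
  set m := Num.floor (1 / y + 1 / 2).
  have -> : cfrac (1 / y) = 1 / y - m%:~R by [].
  move=> Ey; have := Eab _ Ey; rewrite /= in_itv/= => /andP[ay yb].
  have y1 : 2 <= 1 / y by rewrite ler_pdivlMr//; lra.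
  (* Otherwise [1 / y < m + b <= s + 1 + b <= 2], against [1 / y >= 2]. *)
  have ms : (s.+1%:Z < m)%R.
    rewrite ltNge; apply/negP; rewrite -(ler_int R) => ms.
    have {}ms : m%:~R <= s.+1%:R :> R by [].
    by rewrite -natr1 in ms; lra.
  pose j := `|m - s.+2%:Z|%N.
  have mj : m = (j + 2 + s)%N%:Z by move: ms; rewrite /j; clear; lia.
  have mE : m%:~R = branch_shift s j by rewrite branch_shiftE mj.
  exists j => //; split; rewrite /= -?mE//.
  have ma := branch_shiftD_ge2 j sa; rewrite -mE in ma.
  by rewrite in_itv/=; apply/andP; split; [rewrite ge_div1C|rewrite le_div1C]; lra.
move=> [j _ [/=]]; rewrite in_itv/= => /andP[yb ya] Ey.
have := Eab _ Ey; rewrite /= in_itv/= => /andP[ay' yb'].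
have c2 := branch_shiftD_ge2 j sa.
have y0 : 0 < y by apply: lt_le_trans yb; rewrite divr_gt0; lra.
split; last exact/eqP/lt0r_neq0.
split; first by rewrite /folded_dom/= in_itv/= (ltW y0) le_div1C; lra.
rewrite TeE gtr0_norm// (@cfracE _ _ (j + 2 + s)%N).
  by rewrite -[X in _ - X]/((j + 2 + s)%N%:R) -branch_shiftE.
by rewrite -[X in _ - X]/((j + 2 + s)%N%:R) -branch_shiftE; lra.
Qed.

Lemma trivIset_branch_cell s a b (E : set R) : - (1 / 2) <= a -> b <= 1 / 2 ->
  E `<=` `[a, b[%classic -> trivIset setT (branch_cell s a b E).
Proof.
move=> a2 b2 Eab.
have cellE j y : branch_cell s a b E j y -> nearest_int (1 / y) = branch_shift s j.
  move=> [_ /Eab]; rewrite /= in_itv/= branch_shiftE => yE.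
  by rewrite (@nearest_intE _ _ (j + 2 + s)%N)//; move: yE => /=; lra.
move=> i j _ _ [y [/cellE + /cellE]] => -> /eqP.
by rewrite !branch_shiftE eqr_nat !eqn_add2r => /eqP.
Qed.

Lemma measurable_branch_cell s a b (E : set R) j :
  measurable E -> measurable (branch_cell s a b E j).
Proof.
move=> mE; apply: measurableI => //; rewrite -[X in measurable X]setTI.
exact: (@measurable_shift_inv R _ setT).
Qed.

Lemma measurable_folded_dom : measurable (@folded_dom R).
Proof. exact: measurable_itv. Qed.

Lemma measurable_Te_preimage E :
  measurable E -> measurable (@folded_dom R `&` @Te R @^-1` E).
Proof.
move=> mE; apply: measurableI; first exact: measurable_folded_dom.
by rewrite -[X in measurable X]setTI; exact: measurable_Te.
Qed.

(** Each cell is carried onto [E] by [borel_integral_shift_inv]; nonnegativity lets sum and integral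
    be exchanged. *)
Lemma integral_Te_preimage F s a b E : a <= b ->
  0 <= s%:R + a -> s%:R + b <= 1 -> - (1 / 2) <= a -> b <= 1 / 2 ->
  measurable E -> E `<=` `[a, b[%classic ->
  {within @folded_dom R, continuous F} ->
  (forall y, @folded_dom R y -> 0 <= F y) ->
  (\int[leb]_(y in @folded_dom R `&` @Te R @^-1` E) (F y)%:E =
   \int[leb]_(x in E) \sum_(j <oo)
     (F (1 / (branch_shift s j + x)) * (branch_shift s j + x) ^- 2)%R%:E)%E.
Proof.
move=> ab sa sb a2 b2 mE Eab cF F0.
have cell_dom j y : 1 / (branch_shift s j + b) <= y <= 1 / (branch_shift s j + a) ->
    @folded_dom R y.
  have c2 := branch_shiftD_ge2 j sa.
  move=> /andP[yb ya].
  have y0 : 0 < y by apply: lt_le_trans yb; rewrite divr_gt0; lra.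
  rewrite /folded_dom/= in_itv/= (ltW y0) le_div1C; last 2 first; [lra..|].
  by apply: (le_trans c2); rewrite -le_div1C ?ya//; lra.
have mF : measurable_fun (@folded_dom R) F.
  by apply: subspace_continuous_measurable_fun => //; exact: measurable_folded_dom.
have mcell := fun j => @measurable_branch_cell s a b E j mE.
rewrite (@integral_off_point _ ((@folded_dom R `&` @Te R @^-1` E) `\ 0) _ 0).
- rewrite (Te_preimage_branches sa sb a2 b2 Eab) ge0_integral_bigcup//.
  + transitivity (\sum_(j <oo) (\int[leb]_(x in E)
      (F (1 / (branch_shift s j + x)) * (branch_shift s j + x) ^- 2)%R%:E))%E.
      apply: eq_eseriesr => j _.
      have c2 := branch_shiftD_ge2 j sa.
      rewrite borel_integral_shift_inv//; last 3 first.
      * by lra.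
      * apply: continuous_subspaceW cF => y /=; rewrite in_itv/=; exact: cell_dom.
      * by move=> y /cell_dom /F0.
      rewrite (_ : _ `&` E = E)//; apply/seteqP; split=> [x []//|x Ex]; split=> //.
      by have := Eab _ Ex; rewrite /= !in_itv/= => /andP[-> /ltW].
    rewrite integral_nneseries//.
    * move=> j; have c2 := branch_shiftD_ge2 j sa.
      apply: (@measurable_funS _ _ _ _ `[a, b]%classic) => //.
        by move=> x /Eab /=; rewrite !in_itv/= => /andP[-> /ltW].
      apply/measurable_EFinP; apply: measurable_shift_inv_density => //; first lra.
      apply: (measurable_funS measurable_folded_dom _ mF) => y /=.
      rewrite in_itv/=; exact: cell_dom.
    * move=> j x /Eab /=; rewrite in_itv/= => /andP[ax /ltW xb].
      have c2 := branch_shiftD_ge2 j sa.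
      rewrite lee_fin mulr_ge0//; last by rewrite invr_ge0 exprn_ge0//; lra.
      by apply/F0/(cell_dom j)/shift_inv_itv; rewrite ?ax//; lra.
  + apply/measurable_EFinP; apply: (measurable_funS measurable_folded_dom _ mF).
    by move=> y [j _ [+ _]]; rewrite /= in_itv/=; exact: cell_dom.
  + move=> y [j _ [+ _]]; rewrite /= in_itv/= => /cell_dom yI.
    by rewrite lee_fin F0.
  + exact: trivIset_branch_cell.
- by apply: measurableD; [exact: measurable_Te_preimage|exact: measurable_set1].
- exact: measurable_Te_preimage.
- exact: subDsetl.
- by move=> y [yA] /=; apply: contra_notP => y0; split.
- apply/measurable_EFinP; apply: (measurable_funS measurable_folded_dom _ mF).
  exact: subIsetl.
- by move=> y [/F0 + _]; rewrite lee_fin.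
Qed.

End BranchDecomposition.

(** * Transfer of densities by [Te] *)

Section TransferOperator.
Context {R : realType}.
Notation leb := (@lebesgue_measure R).
Notation G := (golden R).
Implicit Types (f F : R -> R) (a b x y t z M L : R) (s j : nat).

Lemma hE x : 0 <= x -> x <= 1 ->
  h x = (2 * G + 1) / (ln G * ((G + x) * (G + 1 - x))).
Proof.
move=> x0 x1; have G1 := @golden_gt R; have l0 := @ln_golden_gt0 R.
by rewrite /h; field; rewrite !lt0r_neq0//; lra.
Qed.

Lemma h_gt0 x : 0 <= x -> x <= 1 -> 0 < h x.
Proof.
move=> x0 x1; have G1 := @golden_gt R; have l0 := @ln_golden_gt0 R.
by rewrite hE// divr_gt0 ?mulr_gt0//; lra.
Qed.

Lemma h_continuous : {within @folded_dom R, continuous (@h R)}.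
Proof.
have G1 := @golden_gt R.
apply: continuous_in_subspaceT => x.
rewrite inE /folded_dom/= in_itv/= => /andP[x0 x2].
rewrite /continuous_at /h; apply: cvgM; first exact: cvg_cst.
apply: cvgD; (apply: cvgM; first exact: cvg_cst).
  apply: cvgV; first by rewrite lt0r_neq0//; lra.
  by apply: cvgD => //; exact: cvg_cst.
apply: cvgV; first by rewrite lt0r_neq0//; lra.
by apply: cvgB => //; exact: cvg_cst.
Qed.

(* [G^2 = G + 1] turns [h (1 / t) / t^2] into a difference. *)
Lemma h_branch t : 2 <= t ->
  h (1 / t) * t ^- 2 = 1 / (ln G * ((t + G - 2) * (t + G - 1))).
Proof.
move=> t2; have G1 := @golden_gt R; have l0 := @ln_golden_gt0 R.
have GG := @golden_sqr R.
(* Both factorizations rest on [G * (G - 1) = 1] and [(G + 1) * (G - 2) = - 1]. *)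
have e1 : G + 1 / t = G * (t + G - 1) / t.
  rewrite (_ : G * (t + G - 1) = G * t + 1); last by lra.
  by field; rewrite lt0r_neq0//; lra.
have e2 : G + 1 - 1 / t = (G + 1) * (t + G - 2) / t.
  rewrite (_ : (G + 1) * (t + G - 2) = (G + 1) * t - 1); last by lra.
  by field; rewrite lt0r_neq0//; lra.
rewrite /h e1 e2.
have -> : 1 / ln G * (1 / (G * (t + G - 1) / t) + 1 / ((G + 1) * (t + G - 2) / t)) *
    t ^- 2 = ((2 * G + 1) * t + 2 * (G * G - G - 1)) /
    (ln G * (G * (G + 1) * t * ((t + G - 2) * (t + G - 1)))).
  by field; rewrite !lt0r_neq0//; lra.
have -> : G * (G + 1) = 2 * G + 1 by lra.
have -> : G * G - G - 1 = 0 by lra.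
by field; rewrite !lt0r_neq0//; lra.
Qed.

(** [flow] is 1-Lipschitz: its difference quotients are [1 / ((1 + G * x) * (1 + G * y))]. *)
Lemma flow_lipschitz_continuous M L f : 0 <= L -> flow_lipschitz M L f ->
  {within @folded_dom R, continuous f}.
Proof.
move=> L0 [_ fL]; apply: (@lipschitz_within_continuous _ _ _ _ L) => x y x0 xy y2.
have y0 := le_trans x0 xy; have G1 := @golden_gt R.
apply: le_trans (fL _ _ x0 xy y2) _; apply: ler_wpM2l => //.
rewrite flowB//; apply: ler_piMr; first lra.
have Gx : 0 <= G * x by apply: mulr_ge0; lra.
have Gy : 0 <= G * y by apply: mulr_ge0; lra.
have h1 : 1 * 1 <= (1 + G * x) * (1 + G * y) by apply: ler_pM; lra.
by rewrite invf_le1; lra.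
Qed.

Lemma avg_continuous M L f : 0 <= L -> flow_lipschitz M L f ->
  {within (`[0, 1]%classic : set R), continuous (avg f)}.
Proof.
move=> L0 fL; apply: (@lipschitz_within_continuous _ _ _ _ L) => x y x0 xy y1.
have y0 := le_trans x0 xy; have G1 := @golden_gt R.
apply: le_trans (avg_lip L0 fL x0 xy) _; apply: ler_wpM2l => //.
rewrite /avg_flow.
rewrite (_ : _ - _ = (y - x) * (2 * ((G + 1 + x) * (G + 1 + y)))^-1); last first.
  by field; rewrite !lt0r_neq0//; lra.
apply: ler_piMr; first lra.
have h1 : 1 * 1 <= (G + 1 + x) * (G + 1 + y) by apply: ler_pM; lra.
by rewrite invf_le1; lra.
Qed.

(** The interval is [[0, 1/2]] for [s = 0] and [[-1/2, 0]] for [s = 1], so that [s%:R + x] stays in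
    [[0, 1]]. *)
Lemma measurable_avg M L f s : (s <= 1)%N -> 0 <= L -> flow_lipschitz M L f ->
  measurable_fun (`[- s%:R / 2, (1 - s%:R) / 2]%classic : set R)
    (fun x => avg f (s%:R + x)).
Proof.
move=> s1 L0 fL.
have mf : measurable_fun (`[0, 1]%classic : set R) (avg f).
  by apply: subspace_continuous_measurable_fun => //; exact: avg_continuous fL.
apply: (measurable_comp _ _ mf) => //; last first.
  by apply: (measurable_funS measurableT) => //; exact: measurable_funD.
move=> _ [x /= + <-]; rewrite !in_itv/=.
by case: s s1 => [|[|//]] _; lra.
Qed.

(** By [h_branch], the factor of [f] in the [j]-th term is [weight j z] divided by [ln G * (G + z)],
    which does not depend on [j]. *)
Lemma branch_sum M L f s x : 0 <= s%:R + x -> s%:R + x <= 1 ->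
  flow_lipschitz M L f ->
  (\sum_(j <oo) (f (1 / (branch_shift s j + x)) * h (1 / (branch_shift s j + x)) *
     (branch_shift s j + x) ^- 2)%R%:E =
   (avg f (s%:R + x) / (ln G * (G + (s%:R + x))))%R%:E)%E.
Proof.
move=> + + [fM _]; set z := s%:R + x => sx0 sx1.
have G1 := @golden_gt R; have l0 := @ln_golden_gt0 R.
have tE j : branch_shift s j + x = j.+2%:R + z by rewrite /branch_shift -addrA.
have term j : f (1 / (branch_shift s j + x)) * h (1 / (branch_shift s j + x)) *
     (branch_shift s j + x) ^- 2 =
     weight j z * f (branch j z) / (ln G * (G + z)).
  have j0 : 0 <= j%:R :> R by rewrite ler0n.
  rewrite -mulrA h_branch; last by rewrite tE -(addn2 j) natrD; lra.
  rewrite tE /weight -/(branch j z) -(natr1 j) -(addn2 j) natrD; field.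
  by rewrite !lt0r_neq0//; lra.
apply/cvg_lim => //.
have -> : (fun n => \sum_(0 <= j < n) (f (1 / (branch_shift s j + x)) *
    h (1 / (branch_shift s j + x)) * (branch_shift s j + x) ^- 2)%R%:E)%E =
    EFin \o (fun n => partial_avg f z n / (ln G * (G + z))).
  apply/funext => n; rewrite sumEFin/= /partial_avg mulr_suml big_mkord.
  by congr (_%:E); apply: eq_bigr => j _; exact: term.
apply: cvg_EFin; first exact: nearW.
by apply: cvgM; [exact: cvg_avg fM|exact: cvg_cst].
Qed.

Lemma integral_Te_density M L f s a b (E : set R) :
  0 <= L -> flow_lipschitz M L f ->
  a <= b -> 0 <= s%:R + a -> s%:R + b <= 1 -> - (1 / 2) <= a -> b <= 1 / 2 ->
  measurable E -> E `<=` `[a, b[%classic ->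
  (\int[leb]_(y in @folded_dom R `&` @Te R @^-1` E) (f y * h y)%R%:E =
   \int[leb]_(x in E) (avg f (s%:R + x) / (ln G * (G + (s%:R + x))))%R%:E)%E.
Proof.
move=> L0 fL ab sa sb a2 b2 mE Eab.
rewrite (integral_Te_preimage (F := fun y => f y * h y) ab sa sb)//.
- apply: eq_integral => x; rewrite inE => /Eab /=; rewrite in_itv/= => /andP[ax xb].
  by rewrite (branch_sum _ _ fL)//; lra.
- have cf := flow_lipschitz_continuous L0 fL; have ch := h_continuous.
  by move=> y; apply: cvgM; [exact: cf|exact: ch].
- move=> y; rewrite /folded_dom/= in_itv/= => yI.
  have /andP[f0 _] := fL.1 y yI.
  by rewrite mulr_ge0// ltW// h_gt0; lra.
Qed.

End TransferOperator.

(** * The folded map *)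

Section FoldedMap.
Context {R : realType}.
Notation leb := (@lebesgue_measure R).
Notation G := (golden R).
Implicit Types (f : R -> R) (x y M L : R) (s n : nat) (E : set R).

(* If [f * h] is a density on the folded domain, its image under [Te] has this
   density, with [s = 0] on [0, 1/2) and [s = 1] on [-1/2, 0). *)
Definition side_density f s x : R :=
  avg f (s%:R + x) / (ln G * (G + (s%:R + x))).

Lemma side_density_ge0 M L f s x : flow_lipschitz M L f -> 0 <= s%:R + x ->
  0 <= side_density f s x.
Proof.
move=> [fM _] sx; have /andP[v0 _] := avg_bounds sx fM.
have G1 := @golden_gt R; have l0 := @ln_golden_gt0 R.
by rewrite divr_ge0 ?mulr_ge0//; lra.
Qed.

Lemma measurable_side_density M L f s : (s <= 1)%N -> 0 <= L ->
  flow_lipschitz M L f ->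
  measurable_fun (`[- s%:R / 2, (1 - s%:R) / 2]%classic : set R)
    (side_density f s).
Proof.
move=> s1 L0 fL; apply: measurable_funM; first exact: measurable_avg fL.
apply: (measurable_funS measurableT) => //.
apply: (measurableT_comp measurable_inv); apply: measurable_funM => //.
by apply: measurable_funD => //; exact: measurable_funD.
Qed.

(** This identity accounts for the coefficients of [gauss_op]: they appear when the two side
    densities are put over the common denominator in [hE]. *)
Lemma gauss_op_h f x : 0 <= x -> x <= 1 / 2 ->
  side_density f 0 x + side_density f 1 (- x) = gauss_op f x * h x.
Proof.
move=> x0 x2; have G1 := @golden_gt R; have l0 := @ln_golden_gt0 R.
rewrite hE /side_density /gauss_op ?add0r; [|lra..].
by field; rewrite !lt0r_neq0//; lra.
Qed.

(** As [T y = |Te y|], the preimage splits by the sign of [Te y], which lies in [[-1/2, 1/2[]. *)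
Lemma T_preimage E : @folded_dom R `&` @T R @^-1` E =
  (@folded_dom R `&` @Te R @^-1` (E `&` `[0, 1 / 2[)) `|`
  (@folded_dom R `&` @Te R @^-1` (-%R @^-1` E `&` `[- (1 / 2), 0[)).
Proof.
apply/seteqP; split=> y.
  move=> [yI]; rewrite /= -normr_Te => Ey.
  have := cfrac_itv (1 / `|y|); rewrite -TeE => /andP[y1 y2].
  have [t0|t0] := leP 0 (Te y); [left|right]; split => //; split.
  - by rewrite (ger0_norm t0) in Ey.
  - by rewrite /= in_itv/= t0.
  - by rewrite (ltr0_norm t0) in Ey.
  - by rewrite /= in_itv/= y1.
move=> [|] [yI []] /=; rewrite in_itv/= -normr_Te => Ey /andP[t0 t1].
  by rewrite ger0_norm.
by rewrite ltr0_norm.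
Qed.

Lemma measurable_oppr_preimage E : measurable E -> measurable (-%R @^-1` E).
Proof.
by move=> mE; rewrite -[X in measurable X]setTI; exact: oppr_measurable.
Qed.

Lemma integral_T_preimage M L f E : 0 <= L -> flow_lipschitz M L f ->
  measurable E ->
  (\int[leb]_(y in @folded_dom R `&` @T R @^-1` E) (f y * h y)%R%:E =
   \int[leb]_(x in @folded_dom R `&` E) (gauss_op f x * h x)%R%:E)%E.
Proof.
move=> L0 fL mE.
have mI := @measurable_folded_dom R.
have mIE : measurable (@folded_dom R `&` E) by exact: measurableI.
have mN := measurable_oppr_preimage mE.
have m1 : measurable (E `&` `[0, 1 / 2[) by exact: measurableI.
have m2 : measurable (-%R @^-1` E `&` `[- (1 / 2), 0[) by exact: measurableI.
have mfh : measurable_fun (@folded_dom R) (fun y => (f y * h y)%:E).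
  apply/measurable_EFinP; apply: measurable_funM;
    apply: subspace_continuous_measurable_fun => //.
    exact: flow_lipschitz_continuous fL.
  exact: h_continuous.
have fh0 y : @folded_dom R y -> (0 <= (f y * h y)%:E)%E.
  rewrite /folded_dom/= in_itv/= => yI; have /andP[f0 _] := fL.1 y yI.
  by rewrite lee_fin mulr_ge0// ltW// h_gt0; lra.
rewrite T_preimage ge0_integral_setU//; first last.
- apply/disj_setPS => y [[_ [_ +]] [_ [_ +]]]; rewrite /= !in_itv/=.
  by move=> /andP[t0 _] /andP[_ t1]; have := le_lt_trans t0 t1; rewrite ltxx.
- by move=> y [[yI _]|[yI _]]; exact: fh0.
- by apply: measurable_funS mfh => // y [[]|[]].
- exact: measurable_Te_preimage.
- exact: measurable_Te_preimage.
rewrite (@integral_Te_density _ M L f 0 0 (1 / 2) _ L0 fL)//; [|lra..].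
rewrite (@integral_Te_density _ M L f 1 (- (1 / 2)) 0 _ L0 fL)//; [|lra..].
pose W s x := (side_density f s x)%:E.
have mW0 : measurable_fun (@folded_dom R) (W 0%N).
  apply/measurable_EFinP.
  have := measurable_side_density (leq0n 1) L0 fL.
  by rewrite mulr0n oppr0 mul0r addr0.
have mW1 : measurable_fun (`[- (1 / 2), 0]%classic : set R) (W 1%N).
  apply/measurable_EFinP.
  have := measurable_side_density (leqnn 1) L0 fL.
  by rewrite mulr1n subrr mul0r mulNr.
have mW1N : measurable_fun (@folded_dom R `&` E) (fun x => W 1%N (- x)).
  apply: (measurable_comp _ _ mW1) => //.
  move=> _ [x [+ _] <-]; rewrite /folded_dom/= !in_itv/= => /andP[x0 x2]; lra.
have W0 s x : 0 <= s%:R + x -> (0 <= W s x)%E.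
  by move=> sx; rewrite lee_fin (side_density_ge0 fL).
(* The endpoint [1 / 2] is added at no cost. *)
have -> : (\int[leb]_(x in E `&` `[0%R, (1 / 2)%R[) W 0%N x =
           \int[leb]_(x in @folded_dom R `&` E) W 0%N x)%E.
  apply/esym; apply: (@integral_off_point _ _ _ (1 / 2)) => //.
  - move=> x [Ex]; rewrite /folded_dom/= !in_itv/= => /andP[-> /ltW ->].
    by split.
  - move=> x [[]]; rewrite /folded_dom/= !in_itv/= => /andP[x0 x2] Ex.
    apply: contra_notP => xn; split => //; rewrite x0 lt_neqAle x2 andbT.
    exact/eqP.
  - by apply: measurable_funS mW0 => // x [].
  - move=> x []; rewrite /folded_dom/= in_itv/= => /andP[x0 _] _.
    by rewrite W0// add0r.
(* The negative side is reflected onto the folded domain; the point [0] is null. *)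
have -> : (\int[leb]_(x in -%R @^-1` E `&` `[(- (1 / 2))%R, 0%R[) W 1%N x =
           \int[leb]_(x in @folded_dom R `&` E) W 1%N (- x)%R)%E.
  rewrite integralN//; first last.
  - by move=> x [_]; rewrite /= in_itv/= => /andP[x0 _]; rewrite W0//; lra.
  - apply: measurable_funS mW1 => // x [_]; rewrite /= !in_itv/=.
    by move=> /andP[-> /ltW].
  apply/esym; apply: (@integral_off_point _ _ _ 0) => //.
  - exact: measurable_oppr_preimage.
  - move=> x [/=]; rewrite opprK => Ex; rewrite /folded_dom/= !in_itv/=.
    by move=> xI; split => //; lra.
  - move=> x [[]]; rewrite /folded_dom/= !in_itv/= => /andP[x0 x2] Ex.
    apply: contra_notP => /eqP xn; rewrite opprK; split => //.
    have : 0 < x by rewrite lt_def xn.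
    by move=> ?; lra.
  - move=> x []; rewrite /folded_dom/= in_itv/= => /andP[_ x2] _.
    by rewrite W0//; lra.
rewrite -ge0_integralD//.
- apply: eq_integral => x; rewrite inE => -[]; rewrite /folded_dom/= in_itv/=.
  by move=> /andP[x0 x2] _; rewrite -EFinD gauss_op_h.
- move=> x []; rewrite /folded_dom/= in_itv/= => /andP[x0 _] _.
  by rewrite W0// add0r.
- by apply: measurable_funS mW0 => // x [].
- move=> x []; rewrite /folded_dom/= in_itv/= => /andP[_ x2] _.
  by rewrite W0//; lra.
Qed.

End FoldedMap.

(** * Estimates with relative error *)

Section Closeness.
Context {R : realType}.
Local Open Scope ereal_scope.
Implicit Types (a b : \bar R) (c e : R).

(** The error is proportional to [b], so that estimates on separate pieces add up. *)
Definition close c e a b := `|a - c%:E * b| <= e%:E * b.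

Lemma closeP c e (a b : R) : close c e a%:E b%:E <-> (`|a - c * b| <= e * b)%R.
Proof. by rewrite /close -!EFinM -EFinB abse_EFin lee_fin. Qed.

Lemma closeD c e a1 a2 b1 b2 :
  a1 \is a fin_num -> a2 \is a fin_num -> b1 \is a fin_num -> b2 \is a fin_num ->
  close c e a1 b1 -> close c e a2 b2 -> close c e (a1 + a2) (b1 + b2).
Proof.
case: a1 => [a1| |]// ; case: a2 => [a2| |]//; case: b1 => [b1| |]//.
case: b2 => [b2| |]// _ _ _ _; rewrite -!EFinD !closeP => h1 h2.
rewrite (_ : (a1 + a2 - c * (b1 + b2) =
  (a1 - c * b1) + (a2 - c * b2))%R); last ring.
by rewrite mulrDr; exact: le_trans (ler_normD _ _) (lerD h1 h2).
Qed.

Lemma closeZ (k : R) c e a b : (0 <= k)%R -> a \is a fin_num -> b \is a fin_num ->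
  close c e a b -> close (k * c) (k * e) (k%:E * a) b.
Proof.
move=> k0; case: a => [a| |]//; case: b => [b| |]// _ _.
rewrite -EFinM !closeP => h.
by rewrite -!mulrA -mulrBr normrM (ger0_norm k0) ler_wpM2l.
Qed.

(** Integration of [g * w <= (c + e) * w] and [c * w <= g * w + e * w], where all integrands are
    nonnegative; finiteness keeps the subtraction meaningful. *)
Lemma integral_close (D : set R) (g w : R -> R) c e :
  measurable D -> measurable_fun D g -> measurable_fun D w ->
  (forall x, D x -> (0 <= g x)%R) -> (forall x, D x -> (0 <= w x)%R) ->
  (0 <= c)%R -> (forall x, D x -> (`|g x - c| <= e)%R) ->
  \int[@lebesgue_measure R]_(x in D) (w x)%:E \is a fin_num ->
  (\int[@lebesgue_measure R]_(x in D) (g x * w x)%:E \is a fin_num) /\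
  close c e (\int[@lebesgue_measure R]_(x in D) (g x * w x)%:E)
    (\int[@lebesgue_measure R]_(x in D) (w x)%:E).
Proof.
move=> mD mg mw g0 w0 c0 gc Bfin.
(* On an empty [D] nothing forces [0 <= e], so this case is settled apart. *)
have [D0|/set0P[x0 Dx0]] := eqVneq D set0.
  by rewrite D0 !integral_set0 closeP !mulr0 subrr normr0.
set A := (X in X \is a fin_num /\ _); set B := (X in close c e A X).
rewrite -/B in Bfin.
have e0 : (0 <= e)%R by exact: le_trans (gc _ Dx0).
have mEw : measurable_fun D (fun x => (w x)%:E) by exact/measurable_EFinP.
have mEgw : measurable_fun D (fun x => (g x * w x)%:E).
  by apply/measurable_EFinP; exact: measurable_funM.
have w0' x : D x -> 0 <= (w x)%:E by move=> /w0; rewrite lee_fin.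
have gw0 x : D x -> 0 <= (g x * w x)%:E.
  by move=> Dx; rewrite lee_fin mulr_ge0 ?g0 ?w0.
have le1 : A <= (c + e)%:E * B.
  rewrite -ge0_integralZl_EFin//; last exact: addr_ge0.
  apply: ge0_le_integral => //.
  - exact: measurable_funeM.
  - move=> x Dx; rewrite -EFinM lee_fin ler_wpM2r ?w0//.
    by have := gc _ Dx; rewrite ler_distl => /andP[].
have A0 : 0 <= A by exact: integral_ge0.
have Afin : A \is a fin_num.
  rewrite ge0_fin_numE//; apply: le_lt_trans le1 _.
  by rewrite -(fineK Bfin) -EFinM ltry.
split => //.
have le2 : c%:E * B <= A + e%:E * B.
  rewrite -!ge0_integralZl_EFin// -ge0_integralD//; first last.
  - exact: measurable_funeM.
  - by move=> x Dx; rewrite mule_ge0 ?lee_fin ?w0.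
  apply: ge0_le_integral => //.
  - by move=> x Dx; rewrite mule_ge0 ?lee_fin ?w0.
  - exact: measurable_funeM.
  - by apply: emeasurable_funD => //; exact: measurable_funeM.
  - move=> x Dx; rewrite -!EFinM -EFinD lee_fin -mulrDl ler_wpM2r ?w0//.
    by have := gc _ Dx; rewrite ler_distl => /andP[]; lra.
move: le1 le2; rewrite -(fineK Bfin) -(fineK Afin) closeP.
rewrite -!EFinM -EFinD !lee_fin ler_norml => le1 le2.
by apply/andP; split; lra.
Qed.

End Closeness.

(** * Densities of the iterates of [T] *)

Section FoldedIteration.
Context {R : realType}.
Notation leb := (@lebesgue_measure R).
Notation G := (golden R).
Notation I := (@folded_dom R).
Implicit Types (f : R -> R) (x y M L : R) (s n : nat) (E : set R).

(** Equal to [1 / h] on the folded domain, by [hE]: Lebesgue measure relative to [mu]. *)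
Definition rho0 x : R := ln G * ((G + x) * (G + 1 - x)) / (2 * G + 1).

(* Density of the law of [T^n] under [leb], relative to [mu]. *)
Definition rho n : R -> R := iter n gauss_op rho0.

(** The numerator [(G + x) * (G + 1 - x)] varies only through [x - x * x], so [rho0] has Lipschitz
    constant at most [ln G]; the 4 bounds [(1 + G * x) * (1 + G * y)], where
    [G * x <= 2 * x <= 1]. *)
Lemma rho0_flow_lipschitz : flow_lipschitz (3 * ln G) (4 * ln G) rho0.
Proof.
have G1 := @golden_gt R; have G2 := @golden_lt R; have l0 := @ln_golden_gt0 R.
split=> [x /andP[x0 x2]|x y x0 xy y2].
  have p0 : 0 <= (G + x) * (G + 1 - x) by apply: mulr_ge0; lra.
  rewrite /rho0 divr_ge0 ?mulr_ge0//=; [|lra..].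
  rewrite ler_pdivrMr; last lra.
  rewrite mulrAC mulrC; apply: ler_wpM2r; first lra.
  have xx : 0 <= x * x by exact: mulr_ge0.
  by have := @golden_sqr R; lra.
have y0 := le_trans x0 xy.
rewrite (_ : rho0 x - rho0 y =
  (ln G * ((y - x) * (x + y - 1))) / (2 * G + 1)); last first.
  by rewrite /rho0; field; rewrite lt0r_neq0//; lra.
rewrite flowB//.
have yx : 0 <= y - x by lra.
apply: (@le_trans _ _ (ln G * (y - x))).
  rewrite !normrM (ger0_norm (ltW l0)) (ger0_norm yx) -!mulrA.
  apply: ler_wpM2l; first exact: ltW.
  apply: ler_piMr => //.
  rewrite (ger0_norm (_ : 0 <= (2 * G + 1)^-1)); last by rewrite invr_ge0; lra.
  rewrite ler_pdivrMr; last lra.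
  by rewrite ler_norml; lra.
rewrite -mulrA [leRHS]mulrCA; apply: ler_wpM2l; first exact: ltW.
have Gx : 0 <= G * x by apply: mulr_ge0; lra.
have Gy : 0 <= G * y by apply: mulr_ge0; lra.
have Gx' : 0 <= (2 - G) * x by apply: mulr_ge0; lra.
have Gy' : 0 <= (2 - G) * y by apply: mulr_ge0; lra.
have h1 : (1 + G * x) * (1 + G * y) <= 2 * 2 by apply: ler_pM; lra.
have h0 : 0 < (1 + G * x) * (1 + G * y) by apply: mulr_gt0; lra.
rewrite mulrA ler_pdivlMr// mulrC; apply: ler_wpM2r => //; lra.
Qed.

Lemma rho_flow_lipschitz n :
  flow_lipschitz (3 * ln G) (rate ^+ n * (4 * ln G)) (rho n).
Proof.
have l0 := @ln_golden_gt0 R.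
elim: n => [|n IH]; first by rewrite expr0 mul1r; exact: rho0_flow_lipschitz.
rewrite exprS -mulrA; apply: gauss_op_lip => //.
by rewrite mulr_ge0 ?exprn_ge0// /rate; lra.
Qed.

Lemma rho_const_ge0 n : 0 <= rate ^+ n * (4 * ln G) :> R.
Proof.
have l0 := @ln_golden_gt0 R.
by rewrite mulr_ge0 ?exprn_ge0// /rate; lra.
Qed.

Lemma iter_T_itv n x : I x -> I (iter n (@T R) x).
Proof.
elim: n => [//|n IH] Ix; rewrite iterS /folded_dom/= in_itv/=; exact: T_itv.
Qed.

Lemma measurable_iter S n : measurable_fun setT S ->
  measurable_fun setT (iter n S : R -> R).
Proof.
move=> mS; elim: n => [|n IH]; first exact: measurable_id.
exact: (measurableT_comp mS IH).
Qed.

Lemma lebesgue_T_preim n E : measurable E ->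
  leb (preim_iter I (@T R) n E) =
  (\int[leb]_(x in I `&` E) (rho n x * h x)%:E)%E.
Proof.
have mI := @measurable_folded_dom R.
have G1 := @golden_gt R; have l0 := @ln_golden_gt0 R.
elim: n E => [|n IH] E mE.
  have mIE : measurable (I `&` E) by exact: measurableI.
  rewrite /preim_iter /= (eq_integral (fun=> 1%E)); last first.
    move=> x; rewrite inE => -[]; rewrite /folded_dom/= in_itv/= => xI _.
    rewrite hE; [|lra..]; rewrite /rho /= /rho0; congr (_%:E); field.
    by rewrite !lt0r_neq0//; lra.
  by rewrite integral_cst// mul1e.
have mTE : measurable (I `&` @T R @^-1` E).
  apply: measurableI => //; rewrite -[X in measurable X]setTI.
  exact: measurable_T.
(* The outermost [T] is peeled off: the induction hypothesis is applied to the preimage of [E] under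
   one step. *)
have -> : preim_iter I (@T R) n.+1 E = preim_iter I (@T R) n (I `&` @T R @^-1` E).
  apply/seteqP; split=> x [Ix /= Ex]; split=> //=.
    by split; first exact: iter_T_itv.
  by case: Ex.
rewrite IH// setIA setIid.
exact: integral_T_preimage (rho_const_ge0 n) (rho_flow_lipschitz n) mE.
Qed.

End FoldedIteration.

(** * Convergence of the densities to [1 / 2] *)

Section Equidistribution.
Context {R : realType}.
Notation leb := (@lebesgue_measure R).
Notation G := (golden R).
Notation I := (@folded_dom R).
Implicit Types (f : R -> R) (x y M L : R) (s n : nat) (E : set R).

Lemma integral_h_folded_dom : (\int[leb]_(x in I) (h x)%:E = 1)%E.
Proof.
have G1 := @golden_gt R; have l0 := @ln_golden_gt0 R; have GG := @golden_sqr R.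
pose H x := (ln G)^-1 * (ln (G + x) - ln (G + 1 - x)).
have dH x : 0 <= x <= 1 / 2 -> is_derive x 1 H (h x).
  move=> /andP[x0 x2].
  have d1 : is_derive x 1 (fun x : R => ln (G + x)) ((G + x)^-1 * (0 + 1)).
    have d0 : is_derive x 1 (cst G + id : R -> R) (0 + 1) by exact: is_deriveD.
    by apply: is_derive1_comp d0; apply: is_derive1_ln; rewrite !fctE; lra.
  have d2 : is_derive x 1 (fun x : R => ln (G + 1 - x)) ((G + 1 - x)^-1 * (0 - 1)).
    have d0 : is_derive x 1 (cst (G + 1) - id : R -> R) (0 - 1).
      exact: is_deriveB.
    by apply: is_derive1_comp d0; apply: is_derive1_ln; rewrite !fctE; lra.
  have -> : h x = (ln G)^-1 *: ((G + x)^-1 * (0 + 1) - (G + 1 - x)^-1 * (0 - 1)).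
    by rewrite /h /GRing.scale/=; field; rewrite !lt0r_neq0//; lra.
  exact: is_deriveZ.
have cH x : 0 <= x <= 1 / 2 -> {for x, continuous H}.
  move=> xI; apply: differentiable_continuous; apply/derivable1_diffP.
  by have := dH x xI => -[].
rewrite /folded_dom (@continuous_FTC2 _ _ H)//.
(* The primitive vanishes at [1 / 2] and equals [- 1] at [0], because
   [ln (G + 1) = ln (G * G) = 2 * ln G]. *)
- rewrite -EFinB /H subr0 addr0 (_ : G + 1 - 1 / 2 = G + 1 / 2); last lra.
  rewrite subrr mulr0 sub0r -GG lnM ?posrE//; [|lra..].
  by congr (_%:E); field; rewrite lt0r_neq0.
- exact: h_continuous.
- split.
  + move=> x; rewrite in_itv/= => /andP[x0 x2].
    by have := dH x; rewrite !ltW// => /(_ isT)[].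
  + by apply: cvg_at_right_filter; apply: cH; lra.
  + by apply: cvg_at_left_filter; apply: cH; lra.
- move=> x; rewrite in_itv/= => /andP[x0 x2].
  by rewrite derive1E; apply: derive_val; apply: dH; rewrite !ltW.
Qed.

Lemma measurable_h : measurable_fun I (@h R).
Proof.
apply: subspace_continuous_measurable_fun; first exact: measurable_folded_dom.
exact: h_continuous.
Qed.

Lemma measurable_rho n : measurable_fun I (@rho R n).
Proof.
apply: subspace_continuous_measurable_fun; first exact: measurable_folded_dom.
exact: (flow_lipschitz_continuous (rho_const_ge0 n) (rho_flow_lipschitz n)).
Qed.

Lemma mu_ge0 E : (0 <= mu E)%E.
Proof.
apply: integral_ge0 => x []; rewrite /folded_dom/= in_itv/= => xI _.
by rewrite lee_fin ltW// h_gt0; lra.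
Qed.

Lemma mu_fin_num E : measurable E -> mu E \is a fin_num.
Proof.
move=> mE; rewrite ge0_fin_numE ?mu_ge0//; apply: (@le_lt_trans _ _ 1%E).
  rewrite -integral_h_folded_dom; apply: ge0_subset_integral => //.
  - by apply: measurableI => //; exact: measurable_folded_dom.
  - exact: measurable_folded_dom.
  - by apply/measurable_EFinP; exact: measurable_h.
  - move=> x; rewrite /folded_dom/= in_itv/= => xI.
    by rewrite lee_fin ltW// h_gt0; lra.
exact: ltry.
Qed.

(** The constant of [rho_flow_lipschitz]; it bounds the whole oscillation of [rho n], since [flow]
    varies by at most [1]. *)
Definition mixing_err n : R := rate ^+ n * (4 * ln G).

Lemma rho_ge0 n x : I x -> 0 <= rho n x.
Proof.
rewrite /folded_dom/= in_itv/= => xI.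
by have /andP[] := (rho_flow_lipschitz n).1 x xI.
Qed.

(** [c] is left free: it is first a value of [rho n], in order to identify the limit, and then
    [1 / 2]. *)
Lemma lebesgue_T_close n E c e : measurable E -> 0 <= c ->
  (forall x, I x -> `|rho n x - c| <= e) ->
  leb (preim_iter I (@T R) n E) \is a fin_num /\
  close c e (leb (preim_iter I (@T R) n E)) (mu E).
Proof.
move=> mE c0 re; have mI := @measurable_folded_dom R.
have mIE : measurable (I `&` E) by exact: measurableI.
rewrite lebesgue_T_preim//; apply: integral_close => //.
- by apply: measurable_funS (measurable_rho n) => // x [].
- by apply: measurable_funS measurable_h => // x [].
- by move=> x [Ix _]; exact: rho_ge0.
- move=> x []; rewrite /folded_dom/= in_itv/= => xI _.
  by rewrite ltW// h_gt0; lra.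
- by move=> x [/re].
- exact: mu_fin_num.
Qed.

Lemma rho_osc n x y : I x -> I y -> `|rho n x - rho n y| <= mixing_err n.
Proof.
wlog xy : x y / x <= y.
  by move=> H Ix Iy; have [/H|/ltW/H] := leP x y; [|rewrite distrC]; exact.
rewrite /folded_dom/= !in_itv/= => /andP[x0 x2] /andP[y0 y2].
apply: le_trans ((rho_flow_lipschitz n).2 _ _ x0 xy y2) _.
rewrite ler_piMr ?rho_const_ge0//.
have G1 := @golden_gt R; have fx := flow_ge0 x0.
have : flow y <= 1; last lra.
have Gy : 0 <= G * y by apply: mulr_ge0; lra.
by rewrite /flow ler_pdivrMr; lra.
Qed.

(** Conservation of mass: on the full domain, of Lebesgue measure [1 / 2] and [mu]-measure [1],
    closeness with [c = rho n x] is exactly the claim. *)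
Lemma rho_near_half n x : I x -> `|rho n x - 1 / 2| <= mixing_err n.
Proof.
move=> Ix; have [_] := @lebesgue_T_close n I (rho n x) (mixing_err n)
  (@measurable_folded_dom R) (rho_ge0 n Ix) (fun y Iy => rho_osc n Iy Ix).
have -> : preim_iter I (@T R) n I = I.
  by apply/seteqP; split=> y; [case|move=> Iy; split => //; exact: iter_T_itv].
rewrite /mu /density_measure setIid integral_h_folded_dom.
rewrite /folded_dom lebesgue_measure_itv/= lte_fin ifT; last lra.
by rewrite sube0 closeP !mulr1 distrC.
Qed.

Lemma folded_close n E : measurable E ->
  leb (preim_iter I (@T R) n E) \is a fin_num /\
  close (1 / 2) (mixing_err n) (leb (preim_iter I (@T R) n E)) (mu E).
Proof. by move=> mE; apply: lebesgue_T_close => // x /rho_near_half. Qed.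

End Equidistribution.

(** * The unfolded maps *)

Section UnfoldedMaps.
Context {R : realType}.
Notation leb := (@lebesgue_measure R).
Notation G := (golden R).
Notation I := (@folded_dom R).
Notation U := (@unfolded_dom R).
Implicit Types (f : R -> R) (x y M L : R) (s n : nat) (E A X N : set R).

Lemma measurable_unfolded_dom : measurable U.
Proof. exact: measurable_itv. Qed.

(** [A] is cut at [0] and its negative part reflected; [0] may be counted twice, being null. *)
Lemma integral_unfold A (g : R -> \bar R) : measurable A -> A `<=` U ->
  measurable_fun A g -> (forall x, A x -> 0 <= g x)%E ->
  (\int[leb]_(x in A) g x =
   \int[leb]_(x in I `&` A) g x + \int[leb]_(x in I `&` -%R @^-1` A) g (- x)%R)%E.
Proof.
move=> mA AU mg g0; have mI := @measurable_folded_dom R.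
have mN := measurable_oppr_preimage mA.
have UE x : A x -> - (1 / 2) <= x <= 1 / 2.
  by move=> /AU; rewrite /unfolded_dom/= in_itv.
have AE : A = (I `&` A) `|` (A `&` `[- (1 / 2), 0[).
  apply/seteqP; split=> x; last by move=> [[]|[]].
  move=> Ax; have /andP[x1 x2] := UE _ Ax.
  by have [x0|x0] := leP 0 x; [left|right]; split => //=;
    rewrite /folded_dom /= in_itv/= x0 ?x1 ?x2.
have m2 : measurable (A `&` `[- (1 / 2), 0[) by exact: measurableI.
have mAI : measurable (I `&` A) by exact: measurableI.
rewrite {1}AE ge0_integral_setU -?AE//; last first.
  apply/disj_setPS => x [[+ _] [_ +]]; rewrite /folded_dom /= !in_itv/=.
  by move=> /andP[t0 _] /andP[_ t1]; have := le_lt_trans t0 t1; rewrite ltxx.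
congr (_ + _)%E.
rewrite (@integralN _ (A `&` `[- (1 / 2), 0[))//; first last.
- by move=> x [Ax _]; exact: g0.
- by apply: measurable_funS mg => // x [].
apply/esym; apply: (@integral_off_point _ _ _ 0).
- exact: measurable_oppr_preimage.
- exact: measurableI.
- move=> x [/= Ax]; rewrite /folded_dom/= !in_itv/= => xI.
  by split=> //; lra.
- move=> x [[+ Ax]]; rewrite /folded_dom/= in_itv/= => /andP[x0 x2].
  apply: contra_notP => /eqP xn; split => //; rewrite /= in_itv/=.
  have : 0 < x by rewrite lt_def xn.
  by move=> ?; lra.
- apply: (@measurable_funS _ _ _ _ (-%R @^-1` A)) => //.
  apply: (measurable_comp mA _ mg) => //.
  by move=> _ [x Ax <-].
- by move=> x [_ Ax]; exact: g0.
Qed.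

Lemma lebesgue_unfold A : measurable A -> A `<=` U ->
  (leb A = leb (I `&` A) + leb (I `&` -%R @^-1` A))%E.
Proof.
move=> mA AU; have mI := @measurable_folded_dom R.
have mN := measurable_oppr_preimage mA.
have := @integral_unfold A (cst 1%E) mA AU.
rewrite !integral_cst//; [|exact: measurableI..].
by rewrite !mul1e; apply.
Qed.

(** [ho] is even and equals half of [h] on the folded domain. *)
Lemma muo_fold E : measurable E -> E `<=` U ->
  muo E = ((1 / 2)%:E * (mu E + mu (-%R @^-1` E)))%E.
Proof.
move=> mE EU; have mI := @measurable_folded_dom R.
have mN := measurable_oppr_preimage mE.
have l0 := @ln_golden_gt0 R.
have hoE x : I x -> ho x = 1 / 2 * h x.
  rewrite /folded_dom/= in_itv/= => /andP[x0 _]; rewrite /ho /h ger0_norm//.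
  by rewrite !mulrA; congr (_ * _); field; rewrite lt0r_neq0.
have hoN x : ho (- x) = ho x by rewrite /ho normrN.
have h0 x : I x -> 0 <= h x.
  by rewrite /folded_dom/= in_itv/= => xI; rewrite ltW// h_gt0; lra.
have normI x : U x -> I `|x|.
  by rewrite /unfolded_dom /folded_dom/= !in_itv/= normr_ge0 ler_norml.
have half A : measurable A ->
    (\int[leb]_(x in I `&` A) (ho x)%:E = (1 / 2)%:E * mu A)%E.
  move=> mA; rewrite /mu /density_measure -ge0_integralZl_EFin//.
  - by apply: eq_integral => x; rewrite inE => -[/hoE -> _]; rewrite EFinM.
  - exact: measurableI.
  - by move=> x [/h0 + _]; rewrite lee_fin.
  - by apply/measurable_EFinP; apply: measurable_funS (@measurable_h R) => // x [].
rewrite ge0_muleDr ?mu_ge0// -!half// /muo /density_measure setIC setIidl//.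
rewrite integral_unfold//.
- by congr (_ + _)%E; apply: eq_integral => x _; rewrite hoN.
- apply/measurable_EFinP.
  apply: (eq_measurable_fun (fun x => 1 / 2 * h `|x|)).
    by move=> x; rewrite inE => /EU /normI /hoE <-; rewrite /ho normr_id.
  apply: measurable_funM => //.
  apply: (measurable_comp (measurable_folded_dom) _ (@measurable_h R)) => //.
  by move=> _ [x /EU /normI ? <-].
- move=> x /EU /normI Ix; rewrite lee_fin.
  have -> : ho x = ho `|x| by rewrite /ho normr_id.
  by rewrite hoE// mulr_ge0 ?h0.
Qed.

End UnfoldedMaps.

(** * The odd map [To] *)

Section OddMap.
Context {R : realType}.
Notation leb := (@lebesgue_measure R).
Notation I := (@folded_dom R).
Notation U := (@unfolded_dom R).
Implicit Types (x y : R) (n : nat) (E A X N : set R).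

Lemma normr_iter_To n x : `|iter n (@To R) x| = iter n (@T R) `|x|.
Proof. by elim: n => //= n IH; rewrite normr_To -T_norm IH. Qed.

Lemma normr_iter_Te n x : `|iter n (@Te R) x| = iter n (@T R) `|x|.
Proof. by elim: n => //= n IH; rewrite normr_Te -T_norm IH. Qed.

(* A rounding tie sends both orbits to [1/2] up to sign, and then to [0]. *)
Lemma iter_To_odd n x : iter n (@T R) `|x| != 1 / 2 ->
  iter n (@To R) (- x) = - iter n (@To R) x.
Proof.
elim: n => [//|n IH] /=.
have [tie _|ntie] := eqVneq (iter n (@T R) `|x|) (1 / 2).
  have To_half y : `|y| = 1 / 2 -> To y = 0.
    have c2 (m : int) : cfrac m%:~R = 0 :> R by rewrite (@cfracE _ _ m) subrr; lra.
    rewrite ToE; have [y0|y0] := leP 0 y.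
      rewrite ger0_norm// => ->; rewrite -(c2 2); congr cfrac; by field.
    rewrite ltr0_norm// => y2; have -> : y = - (1 / 2) by rewrite -y2 opprK.
    by rewrite -(c2 (- 2)); congr cfrac; rewrite mulrNz; field.
  by rewrite !To_half ?oppr0// normr_iter_To ?normrN.
rewrite IH// -normr_iter_To T_norm -normr_To.
(* The hypothesis on the next iterate of [T] rules out the tie excluded in [cfracN]. *)
rewrite !ToE => nT; rewrite invrN mulrN; apply: cfracN.
apply: contra_neq nT => ->; rewrite normrN ger0_norm//; lra.
Qed.

Lemma measurable_preim S A : measurable_fun setT (S : R -> R) -> measurable A ->
  measurable (S @^-1` A).
Proof. by move=> mS mA; rewrite -[X in measurable X]setTI; exact: mS. Qed.

Lemma lebesgue_setD_null A N : measurable A -> measurable N -> leb N = 0%E ->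
  leb A = leb (A `\` N).
Proof.
move=> mA mN N0; rewrite (measureDI leb mA mN).
rewrite [X in (_ + X)%E](_ : _ = 0%E) ?adde0//.
by apply: subset_measure0 N0 => //; exact: measurableI.
Qed.

Lemma lebesgue_split A X : measurable A -> measurable X ->
  leb A = (leb (A `&` X) + leb (A `&` ~` X))%E.
Proof. by move=> mA mX; rewrite (measureDI leb mA mX) addeC setDE. Qed.

(** Let [u] be the [n]-th iterate of [To] at [x] in the folded domain; at [- x] it is [- u], off a
    null set. Where [u >= 0], the conditions [u] in [E] and [- u] in [E] are those defining the two
    preimages under [T]; where [u < 0] they correspond in the opposite order. *)
Lemma lebesgue_To E n : measurable E -> E `<=` U ->
  leb (preim_iter U (@To R) n E) =
  (leb (preim_iter I (@T R) n E) + leb (preim_iter I (@T R) n (-%R @^-1` E)))%E.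
Proof.
move=> mE EU; have mI := @measurable_folded_dom R.
have mNE := measurable_oppr_preimage mE.
have mTn := measurable_iter n (@measurable_T R).
have mTon := measurable_iter n (@measurable_To R).
have mToE := measurable_preim mTon mE.
have mA : measurable (preim_iter U (@To R) n E).
  by apply: measurableI => //; exact: measurable_unfolded_dom.
have mNToE := measurable_oppr_preimage mToE.
have mS : measurable (iter n (@To R) @^-1` `[0, +oo[) by exact: measurable_preim.
set S := _ @^-1` `[0, +oo[ in mS.
(* Points where [iter_To_odd] may fail; a null set because the law of the iterate has a density. *)
pose N := preim_iter I (@T R) n [set 1 / 2].
have mN : measurable N by apply: measurableI => //; exact: measurable_preim.
have N0 : leb N = 0%E.
  by rewrite lebesgue_T_preim// (@integral_Sset1 _ _ _ (1 / 2))// => x [].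
rewrite (lebesgue_unfold mA); last by move=> x [].
have -> : I `&` preim_iter U (@To R) n E = I `&` iter n (@To R) @^-1` E.
  apply/seteqP; split=> x [Ix]; first by case.
  move=> Ex; do 2 split => //; move: Ix.
  by rewrite /folded_dom /unfolded_dom/= !in_itv/= => xI; lra.
have -> : I `&` -%R @^-1` preim_iter U (@To R) n E =
    I `&` (-%R @^-1` (iter n (@To R) @^-1` E)).
  apply/seteqP; split=> x [Ix]; first by case.
  move=> Ex; do 2 split => //; move: Ix.
  by rewrite /folded_dom /unfolded_dom/= !in_itv/= => xI; lra.
have mTE A : measurable A -> measurable (preim_iter I (@T R) n A).
  by move=> ?; apply: measurableI => //; exact: measurable_preim.
have mIE A : measurable A -> measurable (I `&` A) by exact: measurableI.
have split4 A : measurable A ->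
    leb A = (leb ((A `\` N) `&` S) + leb ((A `\` N) `&` ~` S))%E.
  move=> mA'; rewrite (lebesgue_setD_null mA' mN N0); apply: lebesgue_split => //.
  exact: measurableD.
have TN x : I x -> ~ N x -> iter n (@To R) (- x) = - iter n (@To R) x.
  move=> Ix Nx; apply: iter_To_odd; apply/eqP => xT; apply: Nx; split => //=.
  move: Ix; rewrite /folded_dom/= in_itv/= => /andP[x0 _].
  by rewrite -[X in iter n _ X](ger0_norm x0).
have TA x : I x -> iter n (@T R) x = `|iter n (@To R) x|.
  rewrite /folded_dom/= in_itv/= => /andP[x0 _].
  by rewrite normr_iter_To (ger0_norm x0).
have SP x : S x <-> 0 <= iter n (@To R) x by rewrite /S/= in_itv/= andbT.
have SN x : (~` S) x <-> iter n (@To R) x < 0.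
  by rewrite /setC/= SP; split => [/negP|]; rewrite ltNge// => /negP.
rewrite (split4 (I `&` iter n (@To R) @^-1` E))//; last exact: mIE.
rewrite (split4 (I `&` (-%R @^-1` _)))//; last exact: mIE.
rewrite (split4 (preim_iter I (@T R) n E))//; last exact: mTE.
rewrite (split4 (preim_iter I (@T R) n (-%R @^-1` E)))//; last exact: mTE.
(* Pieces are grouped by the sign of the iterate, and the two negative ones are swapped on the
   right. *)
rewrite addeACA [RHS]addeACA [in RHS](addeC (leb (_ `&` ~` S))).
congr (_ + _ + (_ + _))%E; congr (leb _); apply/seteqP; split=> x
  [[[Ix /= Ex] Nx] Sx]; (split; last exact: Sx); (split; last exact: Nx);
  (split; first exact: Ix); move: Ex; rewrite /= ?(TN _ Ix Nx) (TA _ Ix).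
- by move/SP: Sx => Sx; rewrite ger0_norm.
- by move/SP: Sx => Sx; rewrite ger0_norm.
- by move/SP: Sx => Sx; rewrite ger0_norm.
- by move/SP: Sx => Sx; rewrite ger0_norm.
- by move/SN: Sx => Sx; rewrite ltr0_norm// opprK.
- by move/SN: Sx => Sx; rewrite ltr0_norm// opprK.
- by move/SN: Sx => Sx; rewrite ltr0_norm.
- by move/SN: Sx => Sx; rewrite ltr0_norm.
Qed.

(** The estimates for [E] and its reflection are added; since [muo E] is half the sum of the two
    [mu]-measures, both constants double. *)
Lemma odd_close n E : measurable E -> E `<=` U ->
  close 1 (2 * mixing_err n) (leb (preim_iter U (@To R) n E)) (muo E).
Proof.
move=> mE EU; have mNE := measurable_oppr_preimage mE.
have [f1 c1] := folded_close n mE; have [f2 c2] := folded_close n mNE.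
have m1 := mu_fin_num mE; have m2 := mu_fin_num mNE.
have := closeD f1 f2 m1 m2 c1 c2.
rewrite lebesgue_To// muo_fold//.
move: f1 f2 m1 m2 => {c1 c2}.
case: (leb _) => [a1| |]//; case: (leb _) => [a2| |]//.
case: (mu _) => [b1| |]//; case: (mu _) => [b2| |]// _ _ _ _.
rewrite -!EFinD -EFinM !closeP; congr (_ <= _).
  by congr `|_|; ring.
by field.
Qed.

End OddMap.

(** * The even map [Te] *)

Section EvenMap.
Context {R : realType}.
Notation leb := (@lebesgue_measure R).
Notation G := (golden R).
Notation I := (@folded_dom R).
Notation U := (@unfolded_dom R).
Implicit Types (x y : R) (n s : nat) (E A X N : set R).

(** [side_density f s x] is [avg f (s%:R + x) * he_side s x], so closeness of the average to a
    constant passes to the integrals. *)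
Definition he_side s x : R := 1 / (ln G * (G + (s%:R + x))).

Lemma he_sideE x : (he x)%:E =
  (((EFin \o he_side 0) \_ `]0%R, (1 / 2)%R[) x +
   ((EFin \o he_side 1) \_ `](- (1 / 2))%R, 0%R[) x)%E.
Proof.
have G1 := @golden_gt R; have l0 := @ln_golden_gt0 R.
rewrite /he !patchE !mem_setE !in_itv/=.
case: ifPn => [/andP[x0 x2]|_].
  rewrite ifF; last by apply/negbTE; rewrite negb_and -!leNgt (ltW x0) orbT.
  rewrite adde0; congr (_%:E); rewrite /he_side add0r.
  by field; rewrite !lt0r_neq0//; lra.
rewrite add0e; case: ifPn => [/andP[x0 x2]|_ //].
congr (_%:E); rewrite /he_side.
by field; rewrite !lt0r_neq0//; lra.
Qed.

Lemma he_side_bounds s x : 0 <= s%:R + x -> 0 <= he_side s x <= 1 / ln G.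
Proof.
move=> sx; have G1 := @golden_gt R; have l0 := @ln_golden_gt0 R.
have p0 : 0 < ln G * (G + (s%:R + x)) by apply: mulr_gt0; lra.
rewrite divr_ge0//=; last exact: ltW.
rewrite /he_side !mul1r lef_pV2 ?posrE// ler_peMr//; [exact: ltW|lra].
Qed.

Lemma measurable_he_side s A : measurable_fun A (he_side s).
Proof.
apply: (measurable_funS measurableT) => //; apply: measurable_funM => //.
apply: (measurableT_comp measurable_inv); apply: measurable_funM => //.
by apply: measurable_funD => //; exact: measurable_funD.
Qed.

Lemma integral_he_side_fin_num s A : measurable A -> A `<=` U ->
  (forall x, A x -> 0 <= s%:R + x) ->
  (\int[leb]_(x in A) (he_side s x)%:E)%E \is a fin_num.
Proof.
move=> mA AU sA; have l0 := @ln_golden_gt0 R.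
have h0 x : A x -> (0 <= (he_side s x)%:E)%E.
  by move=> /sA /he_side_bounds /andP[]; rewrite lee_fin.
rewrite ge0_fin_numE; last exact: integral_ge0.
apply: (@le_lt_trans _ _ ((1 / ln G)%:E * leb A)%E).
  rewrite -integral_cst//; apply: ge0_le_integral => //.
  - by apply/measurable_EFinP; exact: measurable_he_side.
  - by move=> x /sA /he_side_bounds /andP[_]; rewrite lee_fin.
have : (leb A <= 1)%E.
  apply: (@le_trans _ _ (leb U)).
    by apply: le_measure; rewrite ?inE//; exact: measurable_unfolded_dom.
  rewrite /unfolded_dom lebesgue_measure_itv/= lte_fin ifT; last lra.
  by rewrite -EFinB lee_fin; lra.
move=> A1; apply: (@le_lt_trans _ _ ((1 / ln G)%:E * 1)%E).
  by apply: lee_wpmul2l => //; rewrite lee_fin divr_ge0// ltW.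
by rewrite mule1 ltry.
Qed.

Lemma mue_ge0 E : (0 <= mue E)%E.
Proof.
have h0 s x : 0 <= s%:R + x -> (0 <= (he_side s x)%:E)%E.
  by move=> /he_side_bounds /andP[]; rewrite lee_fin.
apply: integral_ge0 => x _; rewrite he_sideE adde_ge0//; apply: erestrict_ge0 => y;
  by rewrite /= in_itv/= => /andP[y0 _]; rewrite h0//; lra.
Qed.

(** The half-open intervals are those of [integral_Te_density]; they differ from the support of [he]
    by the null points [0] and [- (1 / 2)]. *)
Lemma mue_sides E : measurable E -> E `<=` U ->
  mue E = (\int[leb]_(x in E `&` `[0%R, (1 / 2)%R[) (he_side 0 x)%:E +
           \int[leb]_(x in E `&` `[(- (1 / 2))%R, 0%R[) (he_side 1 x)%:E)%E.
Proof.
move=> mE EU.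
have h0 s x : 0 <= s%:R + x -> (0 <= (he_side s x)%:E)%E.
  by move=> /he_side_bounds /andP[]; rewrite lee_fin.
have mp s a b : measurable_fun E ((EFin \o he_side s) \_ `]a, b[).
  apply: measurable_funTS; apply/(measurable_restrictT _ _).1 => //.
  by apply/measurable_EFinP; exact: measurable_he_side.
rewrite /mue /density_measure setIC setIidl//.
under eq_integral do rewrite he_sideE.
rewrite ge0_integralD//; first last.
- exact: mp.
- move=> x _; apply: erestrict_ge0 => y; rewrite /= in_itv/= => /andP[y0 _].
  by rewrite h0//; lra.
- exact: mp.
- move=> x _; apply: erestrict_ge0 => y; rewrite /= in_itv/= => /andP[y0 _].
  by rewrite h0//; lra.
rewrite -!integral_mkcondr; congr (_ + _)%E; apply/esym.
  apply: (@integral_off_point _ _ _ 0).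
  - exact: measurableI.
  - exact: measurableI.
  - by move=> x [Ex]; rewrite /= !in_itv/= => /andP[/ltW -> ->].
  - move=> x [[Ex]]; rewrite /= !in_itv/= => /andP[x0 x2].
    apply: contra_notP => /eqP xn; split => //.
    by rewrite lt_def xn x0.
  - by apply/measurable_EFinP; exact: measurable_he_side.
  - by move=> x [_]; rewrite /= in_itv/= => /andP[x0 _]; rewrite h0//; lra.
apply: (@integral_off_point _ _ _ (- (1 / 2))).
- exact: measurableI.
- exact: measurableI.
- by move=> x [Ex]; rewrite /= !in_itv/= => /andP[/ltW -> ->].
- move=> x [[Ex]]; rewrite /= !in_itv/= => /andP[x0 x2].
  apply: contra_notP => /eqP xn; split => //.
  by rewrite lt_def xn x0.
- by apply/measurable_EFinP; exact: measurable_he_side.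
- by move=> x [_]; rewrite /= in_itv/= => /andP[x0 _]; rewrite h0//; lra.
Qed.

(** Evenness makes [x] and [- x] contribute equally, hence the factor 2, and leaves the sign
    relevant only in the last step: on the folded domain the first [n] steps may be taken with
    [T]. *)
Lemma lebesgue_Te E n : measurable E -> E `<=` U ->
  leb (preim_iter U (@Te R) n.+1 E) =
  (2%:E * (\int[leb]_(x in E `&` `[0%R, (1 / 2)%R[) (side_density (rho n) 0 x)%:E +
     \int[leb]_(x in E `&` `[(- (1 / 2))%R, 0%R[) (side_density (rho n) 1 x)%:E))%E.
Proof.
move=> mE EU; have mI := @measurable_folded_dom R.
have mTeE : measurable (@Te R @^-1` E).
  exact: measurable_preim (@measurable_Te R) mE.
have mA : measurable (preim_iter U (@Te R) n.+1 E).
  apply: measurableI; first exact: measurable_unfolded_dom.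
  by apply: measurable_preim => //; apply: measurable_iter; exact: measurable_Te.
have TeT x : I x -> iter n.+1 (@Te R) x = Te (iter n (@T R) x).
  rewrite /folded_dom/= in_itv/= => /andP[x0 _].
  by rewrite -[in LHS]Te_norm normr_iter_Te (ger0_norm x0).
have TeN x : iter n.+1 (@Te R) (- x) = iter n.+1 (@Te R) x.
  by rewrite !iterSr -Te_norm normrN Te_norm.
have IU x : I x -> U x.
  by rewrite /folded_dom /unfolded_dom/= !in_itv/= => xI; lra.
have INU x : I x -> U (- x).
  by rewrite /folded_dom /unfolded_dom/= !in_itv/= => xI; lra.
rewrite (lebesgue_unfold mA); last by move=> x [].
have -> : I `&` preim_iter U (@Te R) n.+1 E =
    preim_iter I (@T R) n (@Te R @^-1` E).
  apply/seteqP; split=> x [Ix].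
    by move=> [_ Ex]; split => //; rewrite /= -TeT.
  by move=> Ex; split => //; split; [exact: IU|rewrite /preimage/mkset TeT].
have -> : I `&` -%R @^-1` preim_iter U (@Te R) n.+1 E =
    preim_iter I (@T R) n (@Te R @^-1` E).
  apply/seteqP; split=> x [Ix].
    by move=> [_ Ex]; split => //; rewrite /= -TeT// -TeN.
  by move=> Ex; split => //; split; [exact: INU|rewrite /preimage/mkset TeN TeT].
rewrite mule_natl mule2n; suff -> :
  leb (preim_iter I (@T R) n (@Te R @^-1` E)) =
  (\int[leb]_(x in E `&` `[0%R, (1 / 2)%R[) (side_density (rho n) 0 x)%:E +
   \int[leb]_(x in E `&` `[(- (1 / 2))%R, 0%R[)
     (side_density (rho n) 1 x)%:E)%E by [].
rewrite lebesgue_T_preim//.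
have -> : I `&` @Te R @^-1` E = (I `&` @Te R @^-1` (E `&` `[0, 1 / 2[)) `|`
    (I `&` @Te R @^-1` (E `&` `[- (1 / 2), 0[)).
  apply/seteqP; split=> x; last by move=> [|] [Ix [Ex _]].
  move=> [Ix Ex]; have := cfrac_itv (1 / `|x|); rewrite -TeE => /andP[x1 x2].
  by have [x0|x0] := leP 0 (Te x); [left|right]; do 2 split => //;
    rewrite /= in_itv/= ?x0 ?x1 ?x2.
have m1 : measurable (E `&` `[0, 1 / 2[) by exact: measurableI.
have m2 : measurable (E `&` `[- (1 / 2), 0[) by exact: measurableI.
have rL := @rho_flow_lipschitz R n; have r0 := @rho_const_ge0 R n.
have mfh : measurable_fun I (fun y => (rho n y * h y)%:E).
  by apply/measurable_EFinP; apply: measurable_funM;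
    [exact: measurable_rho|exact: measurable_h].
have fh0 y : I y -> (0 <= (rho n y * h y)%:E)%E.
  move=> Iy; rewrite lee_fin mulr_ge0 ?rho_ge0//.
  by move: Iy; rewrite /folded_dom/= in_itv/= => yI; rewrite ltW// h_gt0; lra.
rewrite ge0_integral_setU//; first last.
- apply/disj_setPS => y [[_ [_ +]] [_ [_ +]]]; rewrite /= !in_itv/=.
  by move=> /andP[t0 _] /andP[_ t1]; have := le_lt_trans t0 t1; rewrite ltxx.
- by move=> y [[yI _]|[yI _]]; exact: fh0.
- by apply: measurable_funS mfh => // y [[]|[]].
- exact: measurable_Te_preimage.
- exact: measurable_Te_preimage.
rewrite (@integral_Te_density _ _ _ (rho n) 0 0 (1 / 2) _ r0 rL)//; [|lra..].
by rewrite (@integral_Te_density _ _ _ (rho n) 1 (- (1 / 2)) 0 _ r0 rL)//; lra.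
Qed.

(** By [avg_near], averaging [rho n] keeps it within [mixing_err n] of [1 / 2], so the index of the
    error is one less than the number of iterations. *)
Lemma even_close n E : measurable E -> E `<=` U ->
  close 1 (2 * mixing_err n) (leb (preim_iter U (@Te R) n.+1 E)) (mue E).
Proof.
move=> mE EU; rewrite lebesgue_Te// mue_sides//.
have side s (A : set R) : measurable A ->
    A `<=` (`[- s%:R / 2, (1 - s%:R) / 2]%classic : set R) -> (s <= 1)%N ->
  ((\int[leb]_(x in A) (side_density (rho n) s x)%:E)%E \is a fin_num /\
   (\int[leb]_(x in A) (he_side s x)%:E)%E \is a fin_num) /\
  close (1 / 2) (mixing_err n) (\int[leb]_(x in A) (side_density (rho n) s x)%:E)
    (\int[leb]_(x in A) (he_side s x)%:E).
  move=> mA As s1.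
  have sA x : A x -> 0 <= s%:R + x.
    by move=> /As; rewrite /= in_itv/=; case: s s1 {As} => [|[|//]] _; lra.
  have AU : A `<=` U.
    move=> x /As; rewrite /unfolded_dom/= !in_itv/=.
    by case: s s1 {As sA} => [|[|//]] _; lra.
  have fin := integral_he_side_fin_num mA AU sA.
  have rL := @rho_flow_lipschitz R n; have r0 := @rho_const_ge0 R n.
  have [] := @integral_close R A (fun x => avg (rho n) (s%:R + x)) (he_side s)
    (1 / 2) (mixing_err n).
  - exact: mA.
  - exact: measurable_funS (measurable_avg s1 r0 rL).
  - exact: measurable_he_side.
  - by move=> x /sA sx; have /andP[] := avg_bounds sx rL.1.
  - by move=> x /sA /he_side_bounds /andP[].
  - by lra.
  - move=> x /sA sx; apply: (avg_near sx rL.1) => y yI.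
    by apply: rho_near_half; rewrite /folded_dom/= in_itv.
  - exact: fin.
  have -> : (\int[leb]_(x in A) (avg (rho n) (s%:R + x) * he_side s x)%:E =
     \int[leb]_(x in A) (side_density (rho n) s x)%:E)%E.
    by apply: eq_integral => x _; rewrite /he_side /side_density mul1r.
  by [].
have [[f1 g1] c1] := side 0%N (E `&` `[0, 1 / 2[)
  (measurableI _ _ mE (measurable_itv _))
  ltac:(by move=> x [_]; rewrite /= !in_itv/=; lra) isT.
have [[f2 g2] c2] := side 1%N (E `&` `[- (1 / 2), 0[)
  (measurableI _ _ mE (measurable_itv _))
  ltac:(by move=> x [_]; rewrite /= !in_itv/=; lra) isT.
have := closeZ (ler0n R 2) _ _ (closeD f1 f2 g1 g2 c1 c2).
rewrite (_ : 2 * (1 / 2) = 1); last by field.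
by apply; rewrite fin_numD ?f1 ?g1.
Qed.

End EvenMap.

(** * From the proved rate to the stated ones *)

Lemma close_rate (R : realType) (K c : R) (n : nat) (q : R) (a b : \bar R) :
  0 <= K -> rate <= q -> (0 <= b)%E -> close c (K * rate ^+ n) a b ->
  (`|a - c%:E * b| <= K%:E * (b * (q ^+ n)%:E))%E.
Proof.
move=> K0 rq b0 h; apply: le_trans h _.
rewrite EFinM -muleA; apply: lee_wpmul2l; first by rewrite lee_fin.
rewrite muleC; apply: lee_wpmul2l => //; rewrite lee_fin.
by apply: lerXn2r => //; rewrite ?nnegrE; move: rq; rewrite /rate; lra.
Qed.

Theorem theorem1 (R : realType) :
  (exists2 C : R, 0 < C &
    forall (n : nat) (E : set R), (1 <= n)%N ->
      measurable E -> E `<=` @folded_dom R ->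
      (`| @lebesgue_measure R (preim_iter (@folded_dom R) (@T R) n E)
          - (1 / 2)%:E * mu E |
       <= C%:E * (mu E * ((288 / 1000) ^+ n)%:E))%E) /\
  (exists2 C : R, 0 < C &
    forall (n : nat) (E : set R), (1 <= n)%N ->
      measurable E -> E `<=` @unfolded_dom R ->
      (`| @lebesgue_measure R (preim_iter (@unfolded_dom R) (@To R) n E)
          - muo E |
       <= C%:E * (muo E * ((288 / 1000) ^+ n)%:E))%E) /\
  (exists2 C : R, 0 < C &
    forall (n : nat) (E : set R), (1 <= n)%N ->
      measurable E -> E `<=` @unfolded_dom R ->
      (`| @lebesgue_measure R (preim_iter (@unfolded_dom R) (@Te R) n E)
          - mue E |
       <= C%:E * (mue E * ((234 / 1000) ^+ n)%:E))%E).
Proof.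
have l0 := @ln_golden_gt0 R.
split; [|split].
(* The initial Lipschitz constant, that of [rho0]; it doubles for the unfolded maps. *)
- exists (4 * ln (golden R)) => [|n E n1 mE EI]; first lra.
  have [_ c1] := folded_close n mE.
  apply: close_rate; [lra|by rewrite /rate; lra|exact: mu_ge0|].
  by move: c1; congr (close _ _ _ _); rewrite /mixing_err mulrC.
- exists (8 * ln (golden R)) => [|n E n1 mE EU]; first lra.
  rewrite -[X in (_ - X)%E]mul1e.
  apply: close_rate; [lra|by rewrite /rate; lra| |].
    rewrite muo_fold//; apply: mule_ge0; last by rewrite adde_ge0 ?mu_ge0.
    by rewrite lee_fin; lra.
  have := odd_close n mE EU; congr (close _ _ _ _).
  by rewrite /mixing_err; ring.
(* After [n + 1] iterations the error carries only [rate ^+ n], so one factor [rate] is absorbed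
   into the constant. *)
exists (8 * ln (golden R) / rate) => [|[//|n] E _ mE EU].
  by rewrite /rate; lra.
rewrite -[X in (_ - X)%E]mul1e.
apply: close_rate; [by rewrite /rate; lra|by rewrite /rate; lra|exact: mue_ge0|].
have := even_close n mE EU; congr (close _ _ _ _).
by rewrite /mixing_err exprS /rate; field.
Qed.
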